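(* Let $H_1,H_2$ be separable Hilbert spaces and let $\mathcal L_i\subset B(H_i)$, $i=1,2$, be totally atomic CSLs. If $\mathcal L_1$ and $\mathcal L_2$ are isomorphic as CSLs, then the algebras $\mathrm{Alg}(\mathcal L_1)$ and $\mathrm{Alg}(\mathcal L_2)$ are weak TRO equivalent, and therefore $k_c(\mathrm{Alg}(\mathcal L_1))=k_c(\mathrm{Alg}(\mathcal L_2))$.
   Context: CSLs: a lattice $\mathcal L\subset B(H)$ is a set of (orthogonal) projections containing $0$ and the identity and closed under arbitrary suprema and infima; a commutative subspace lattice (CSL) is such a lattice whose elements commute. $\mathrm{Alg}(\mathcal L)=\{A\in B(H):L^\perp AL=0\ \forall L\in\mathcal L\}$. A CSL $\mathcal L$ is totally atomic if the von Neumann algebra $\mathcal L''$ is atomic, i.e. the identity is the supremum of the minimal projections of $\mathcal L''$. Two CSLs $\mathcal L_1,\mathcal L_2$ are isomorphic if there is a bijection from $\mathcal L_1$ onto $\mathcal L_2$ which is order preserving in both directions. Weak TRO equivalence: a TRO is a subspace $\mathcal M\subset B(H,K)$ with $\mathcal M\mathcal M^*\mathcal M\subset\mathcal M$. Weak* closed spaces $\mathcal U\subset B(K_1,K_2)$ and $\mathcal V\subset B(H_1,H_2)$ are weak TRO equivalent if there exist TROs $\mathcal M_i\subset B(H_i,K_i)$, $i=1,2$, such that $\mathcal U=[\mathcal M_2\mathcal V\mathcal M_1^*]^{-w^*}$ and $\mathcal V=[\mathcal M_2^*\mathcal U\mathcal M_1]^{-w^*}$, where $[\,\cdot\,]^{-w^*}$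 is the weak* closed linear span. Matrices: for a weak* closed space $\mathcal X\subset B(H,K)$, $M_\infty^w(\mathcal X)$ is the space of $\aleph_0\times\aleph_0$ matrices with entries in $\mathcal X$ whose finite submatrices have uniformly bounded norm, regarded as a subspace of $B(H^\infty,K^\infty)$, where $H^\infty$, $K^\infty$ are the Hilbert space direct sums of $\aleph_0$ copies. Hyperreflexivity constant: for a subspace $\mathcal X\subset B(H,K)$ and $T\in B(H,K)$ put $d(T,\mathcal X)=\inf_{X\in\mathcal X}\|T-X\|$ and $r_{\mathcal X}(T)=\sup\{|\langle T\xi,\eta\rangle|:\|\xi\|=\|\eta\|=1,\ \langle X\xi,\eta\rangle=0\ \forall X\in\mathcal X\}$. $\mathcal X$ is hyperreflexive if there is $k>0$ with $d(T,\mathcal X)\le k\,r_{\mathcal X}(T)$ for all $T$; $k(\mathcal X)=\sup_{T\notin\mathcal X} d(T,\mathcal X)/r_{\mathcal X}(T)$, with $k(\mathcal X)=\infty$ if $\mathcal X$ is not hyperreflexive and $k(\mathcal X)=1$ if $\mathcal X=B(H,K)$. The complete hyperreflexivity constant is $k_c(\mathcal X)=k(M_\infty^w(\mathcal X))\in[1,\infty]$. *)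

(* Defs.v *)
From HB Require Import structures.
From mathcomp Require Import all_boot all_order all_algebra complex.
From mathcomp Require Import boolp classical_sets functions cardinality reals.
From mathcomp Require Import ereal topology normedtype sequences.
From mathcomp Require Import ring lra.

Set Implicit Arguments.
Unset Strict Implicit.
Unset Printing Implicit Defensive.

Import Order.TTheory GRing.Theory Num.Theory Num.Def.
Import numFieldNormedType.Exports.

Local Open Scope classical_set_scope.
Local Open Scope ring_scope.

(* Complex Hilbert spaces, over R[i] for R a type of real numbers; hdot is linear
   in its first argument and conjugate-linear in the second. *)
HB.mixin Record isHilbert (R : realType) H & CompleteNormedModule R[i] H := {
  hdot : {dot H for (@conjC R[i])};
  hdot_norm : forall x : H, `|x| ^+ 2 = hdot x x }.

#[short(type="hilbertType")]
HB.structure Definition Hilbert (R : realType) :=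
  {H of isHilbert R H & CompleteNormedModule R[i] H}.

(* The library norm of a complex normed module has values in R[i]. *)
Definition rnorm (R : realType) (V : normedZmodType R[i]) (x : V) : R :=
  complex.Re `|x|.

Section rnorm_theory.
Variables (R : realType).
Local Notation C := R[i].

Lemma ge0_cReK (z : C) : 0 <= z -> (complex.Re z)%:C%C = z.
Proof. by move=> /ger0_real/RRe_real. Qed.

Lemma rnormE (V : normedZmodType C) (x : V) : (rnorm x)%:C%C = `|x|.
Proof. exact/ge0_cReK/normr_ge0. Qed.

Lemma rnorm_ge0 (V : normedZmodType C) (x : V) : 0 <= rnorm x.
Proof. by rewrite -lecR rnormE normr_ge0. Qed.

Lemma rnormD (V : normedZmodType C) (x y : V) :
  rnorm (x + y) <= rnorm x + rnorm y.
Proof. by rewrite -lecR rmorphD/= !rnormE ler_normD. Qed.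

Lemma rnormZ (V : normedModType C) (a : C) (x : V) :
  rnorm (a *: x) = rnorm (a : C) * rnorm x.
Proof. by apply: complexI; rewrite rmorphM/= !rnormE normrZ. Qed.

Lemma rnorm0 (V : normedZmodType C) : rnorm (0 : V) = 0.
Proof. by rewrite /rnorm normr0. Qed.

Lemma rnorm_dist (V : normedZmodType C) (x y : V) :
  `|rnorm x - rnorm y| <= rnorm (x - y).
Proof.
have hx := rnormD (x - y) y; have hy := rnormD (y - x) x.
have hxy : rnorm (y - x) = rnorm (x - y) by rewrite /rnorm distrC.
by rewrite !subrK hxy in hx hy; rewrite ler_norml; apply/andP; split; lra.
Qed.

Lemma rnorm_continuous (V : normedModType C) : continuous (@rnorm R V).
Proof.
move=> x; apply/cvgrPdist_lt => e e0; near=> y.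
rewrite (le_lt_trans (rnorm_dist _ _))// -ltcR rnormE.
near: y; apply: cvgr_dist_lt; first exact: cvg_id.
by rewrite ltcR.
Unshelve. all: by end_near. Qed.

Lemma real_complex_continuous :
  continuous (fun x : R => (x%:C%C : C^o)).
Proof.
move=> x; apply/cvgrPdist_lt => e e0; near=> y.
rewrite -rmorphB/= normc_def/= expr0n addr0 sqrtr_sqr -(ge0_cReK (ltW e0)) ltcR.
near: y; apply: cvgr_dist_lt; first exact: cvg_id.
by rewrite -ltcR ge0_cReK// ltW.
Unshelve. all: by end_near. Qed.

Lemma rnorm2_add (V : normedZmodType C) (x y : V) :
  rnorm (x + y) ^+ 2 <= (rnorm x ^+ 2 + rnorm y ^+ 2) *+ 2.
Proof.
have : rnorm (x + y) ^+ 2 <= (rnorm x + rnorm y) ^+ 2.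
  by rewrite lerXn2r ?nnegrE ?addr_ge0 ?rnorm_ge0// rnormD.
move=> /le_trans; apply.
have := sqr_ge0 (rnorm x - rnorm y); rewrite sqrrB sqrrD.
move: (rnorm x) (rnorm y) => a b h.
lra.
Qed.

End rnorm_theory.

Section sesqui.
Variables (R : realType) (U : lmodType R[i]) (f : {dot U for (@conjC R[i])}).
Local Notation C := R[i].

Lemma dotC x y : f x y = (f y x)^*.
Proof. by rewrite [LHS](hermC f x y) expr0 mul1r. Qed.

Lemma dot0 x : f x 0 = 0. Proof. exact: linear0r. Qed.

Lemma dot_ge0 x : 0 <= f x x.
Proof.
have [->|x0] := eqVneq x 0; first by rewrite dot0.
exact/ltW/(neq0_dnorm_gt0 (s:=f)).
Qed.

Lemma dot_CauchySchwarz x y : `|f x y| ^+ 2 <= f x x * f y y.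
Proof.
have [->|y0] := eqVneq y 0; first by rewrite !dot0 normr0 expr0n mulr0.
have fy0 : 0 < f y y by exact: (neq0_dnorm_gt0 (s:=f)).
have := dot_ge0 (x - (f x y / f y y) *: y).
rewrite linearBl/= !linearBr/= !linearZl_LR/= !linearZr_LR/=.
rewrite rmorphM/= fmorphV/= -(dotC y y) -(dotC y x) (dotC y x).
rewrite -(ler_pM2r fy0) mul0r => h; rewrite -subr_ge0; apply: (le_trans h).
rewrite normCK le_eqVlt; apply/orP; left; apply/eqP; field.
by rewrite gt_eqF.
Qed.

Definition dnorm x : C := sqrtC (f x x).

Lemma dnorm_sqr x : dnorm x ^+ 2 = f x x.
Proof. exact: sqrtCK. Qed.

Lemma dnorm_ge0 x : 0 <= dnorm x.
Proof. by rewrite sqrtC_ge0 dot_ge0. Qed.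

Lemma dnormD x y : dnorm (x + y) <= dnorm x + dnorm y.
Proof.
rewrite -ler_sqr ?nnegrE ?addr_ge0 ?dnorm_ge0// dnorm_sqr.
rewrite linearDl/= !linearDr/= sqrrD !dnorm_sqr.
have h : `|f x y| <= dnorm x * dnorm y.
  rewrite -ler_sqr ?nnegrE ?mulr_ge0 ?dnorm_ge0// exprMn !dnorm_sqr.
  exact: dot_CauchySchwarz.
have h2 : f x y + f y x <= (dnorm x * dnorm y) *+ 2.
  have := le_trans (leif_Re_Creal (f x y)) h.
  by rewrite ReE -(dotC y x) ler_pdivrMr ?ltr0n// mulr_natr.
by rewrite -!addrA lerD2l !addrA lerD2r.
Qed.

Lemma dnormZ (a : C) x : dnorm (a *: x) = `|a| * dnorm x.
Proof.
apply/eqP; rewrite -(@eqrXn2 _ 2)// ?mulr_ge0 ?dnorm_ge0//.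
by rewrite exprMn !dnorm_sqr linearZl_LR/= linearZr_LR/= mulrA -normCK.
Qed.

Lemma dnorm_eq0 x : dnorm x = 0 -> x = 0.
Proof.
move=> x0; apply/eqP; apply: contraT => /(neq0_dnorm_gt0 (s:=f)).
by rewrite -dnorm_sqr x0 expr0n ltxx.
Qed.

Lemma dot_polarization x y : f x y = 4^-1 *
  (f (x + y) (x + y) - f (x - y) (x - y)
   + 'i * f (x + 'i *: y) (x + 'i *: y) - 'i * f (x - 'i *: y) (x - 'i *: y)).
Proof.
rewrite !(linearDl, linearNl, linearDr, linearNr, linearZl_LR, linearZr_LR)/=.
rewrite conjCi.
have := @sqrCi C.
move: ('i : C) => j jj.
apply: (@mulfI _ 4); first by rewrite pnatr_eq0.
rewrite mulVKf ?pnatr_eq0//.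
rewrite [RHS](_ : _ = 2 * (f x y) + 2 * (f y x) - 2 * j ^+ 2 * (f x y) + 2 * j ^+2 * f y x); last by ring.
rewrite jj; ring.
Qed.
End sesqui.

(* ell2 H is the Hilbert space direct sum H^\infty of aleph_0 copies of H. *)
Section ell2.
Variables (R : realType) (H : hilbertType R).
Local Notation C := R[i].

Definition sqsummable : {pred nat -> H} :=
  fun x => `[< cvgn (series (fun i => rnorm (x i) ^+ 2)) >].

Lemma sqsummableP (x : nat -> H) :
  reflect (cvgn (series (fun i => rnorm (x i) ^+ 2))) (x \in sqsummable).
Proof. exact: asboolP. Qed.

Lemma sqsummable_submod_closed : submod_closed sqsummable.
Proof.
split=> [|a x y /sqsummableP x2 /sqsummableP y2]; apply/sqsummableP.
  have -> : series (fun i => rnorm ((0 : nat -> H) i) ^+ 2) = fun=> 0 :> R.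
    apply/funext => n; rewrite /series/= big1// => i _. by rewrite (@rnorm0 _ H) expr0n.
  exact: is_cvg_cst.
apply: (@series_le_cvg _ _ (fun i => (rnorm (a : C) ^+ 2 * 2) *: (rnorm (x i) ^+ 2)
   + 2 *: (rnorm (y i) ^+ 2))) => [i|i|i|].
- exact: sqr_ge0.
- apply: addr_ge0; apply: mulr_ge0; rewrite ?sqr_ge0//.
  by apply: mulr_ge0; rewrite ?sqr_ge0.
- apply: (le_trans (rnorm2_add (a *: x i) (y i))).
  by rewrite rnormZ exprMn /GRing.scale/=; lra.
- by apply: is_cvg_seriesD; exact: is_cvg_seriesZ.
Qed.

HB.instance Definition _ :=
  GRing.isSubmodClosed.Build C (nat -> H) sqsummable sqsummable_submod_closed.

Record ell2 := Ell2 { ell2_seq :> nat -> H ; _ : ell2_seq \in sqsummable }.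

HB.instance Definition _ := [isSub for ell2_seq].
HB.instance Definition _ := [Choice of ell2 by <:].
HB.instance Definition _ := [SubChoice_isSubLmodule of ell2 by <:].

Lemma ell2P (x : ell2) : cvgn (series (fun i => rnorm (x i) ^+ 2)).
Proof. by case: x => x /= /sqsummableP. Qed.

Lemma ell2_valP (x : ell2) : (x : nat -> H) \in sqsummable.
Proof. by case: x. Qed.

Lemma ell2DE (x y : ell2) i : (x + y) i = x i + y i.
Proof. by rewrite -[LHS]/((\val (x + y)) i) raddfD. Qed.

Lemma ell2ZE a (x : ell2) i : (a *: x) i = a *: x i.
Proof. by rewrite -[LHS]/((\val (a *: x)) i) linearZ. Qed.

Lemma ell2NE (x : ell2) i : (- x) i = - x i.
Proof. by rewrite -[LHS]/((\val (- x)) i) raddfN. Qed.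

Lemma ell2P_eq (x y : ell2) : (forall i, x i = y i) -> x = y.
Proof. by move=> xy; apply/val_inj/funext. Qed.

Lemma hdot_rnorm (x : H) : hdot x x = (rnorm x ^+ 2)%:C%C.
Proof. by rewrite rmorphXn/= rnormE hdot_norm. Qed.

Definition ell2_dot (x y : ell2) : C :=
  limn (series (fun i => hdot (x i) (y i) : C^o)).

Lemma is_cvg_ell2_dot (x y : ell2) :
  cvgn (series (fun i => hdot (x i) (y i) : C^o)).
Proof.
have cvgxx (z : ell2) : cvgn (series (fun i => hdot (z i) (z i) : C^o)).
  apply/cvg_ex; exists (limn (series (fun i => rnorm (z i) ^+ 2)))%:C%C.
  have -> : series (fun i => hdot (z i) (z i) : C^o) =
      (fun r : R => r%:C%C : C^o) \o series (fun i => rnorm (z i) ^+ 2).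
    apply/funext => n; rewrite /series/= rmorph_sum/=.
    by apply: eq_bigr => i _; rewrite hdot_rnorm.
  apply: continuous_cvg; first exact: real_complex_continuous.
  exact: ell2P.
pose u (c : C) := fun i => hdot ((x + c *: y) i) ((x + c *: y) i) : C^o.
have -> : (fun i => hdot (x i) (y i) : C^o) = 4^-1 \*:
    (u 1 - u (-1) + 'i \*: u 'i - 'i \*: u (- 'i)).
  apply/funext => i; rewrite [LHS]dot_polarization.
  have uE c : u c i = hdot (x i + c *: y i) (x i + c *: y i).
    by rewrite /u ell2DE ell2ZE.
  rewrite -[RHS]/(4^-1 * (u 1 i - u (-1) i + 'i * u 'i i - 'i * u (- 'i) i)).
  by rewrite !uE !scaleNr !scale1r.
apply: is_cvg_seriesZ; apply: is_cvg_seriesB; last exact/is_cvg_seriesZ/cvgxx.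
apply: is_cvg_seriesD; last exact/is_cvg_seriesZ/cvgxx.
by apply: is_cvg_seriesB; exact: cvgxx.
Qed.

Lemma ell2_dot_linear (y : ell2) : scalar (ell2_dot ^~ y).
Proof.
move=> a x x'; rewrite /ell2_dot; apply/cvg_lim => //.
have E i : hdot ((a *: x + x') i) (y i) =
    a * hdot (x i) (y i) + hdot (x' i) (y i).
  by rewrite ell2DE ell2ZE linearDl/= linearZl_LR.
have -> : series (fun i => hdot ((a *: x + x') i) (y i) : C^o) =
  a *: series (fun i => hdot (x i) (y i) : C^o) +
  series (fun i => hdot (x' i) (y i) : C^o).
  apply/funext => n; rewrite !fctE /series/= scaler_sumr -big_split/=.
  by apply: eq_bigr => i _; exact: E.
by apply: cvgD; [apply: cvgZr|]; exact: is_cvg_ell2_dot.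
Qed.

Lemma conjC_continuous : continuous (@conjC C : C^o -> C^o).
Proof.
move=> x; apply/(@cvgrPdist_lt C C^o _ (nbhs (x : C^o)) _ (@conjC C)) => e e0.
exists e => //= y; rewrite /ball_/= => xy.
by rewrite -rmorphB/= norm_conjC.
Qed.

Lemma ell2_dotC (x y : ell2) : ell2_dot x y = (ell2_dot y x)^*.
Proof.
apply: (@cvg_lim C^o) => //.
have -> : series (fun i => hdot (x i) (y i) : C^o) =
   (@conjC C : C^o -> C^o) \o series (fun i => hdot (y i) (x i) : C^o).
  apply/funext => n; rewrite /series/= rmorph_sum/=.
  by apply: eq_bigr => i _; rewrite [LHS]dotC.
apply: continuous_cvg; first exact: conjC_continuous.
exact: is_cvg_ell2_dot.
Qed.

Lemma ell2_dotxx (x : ell2) :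
  ell2_dot x x = (limn (series (fun i => rnorm (x i) ^+ 2)))%:C%C.
Proof.
apply: (@cvg_lim C^o) => //.
have -> : series (fun i => hdot (x i) (x i) : C^o) =
    (fun r : R => r%:C%C : C^o) \o series (fun i => rnorm (x i) ^+ 2).
  apply/funext => n; rewrite /series/= rmorph_sum/=.
  by apply: eq_bigr => i _; rewrite hdot_rnorm.
apply: continuous_cvg; first exact: real_complex_continuous.
exact: ell2P.
Qed.

Lemma ell2_partial_le (x : ell2) n :
  series (fun i => rnorm (x i) ^+ 2) n <=
  limn (series (fun i => rnorm (x i) ^+ 2)).
Proof.
apply: nondecreasing_cvgn_le; last exact: ell2P.
by apply: nondecreasing_series => i _ _; exact: sqr_ge0.
Qed.

Lemma ell2_dot_gt0 (x : ell2) : x != 0 -> 0 < ell2_dot x x.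
Proof.
move=> x0; rewrite ell2_dotxx ltcR.
have [i xi0] : exists i, x i != 0.
  apply: contrapT => /forallNP h; move/eqP: x0; apply; apply: ell2P_eq => i.
  by have /negP/negPn/eqP -> := h i.
apply: lt_le_trans (ell2_partial_le x i.+1).
rewrite /series/= big_nat_recr//= ltr_wpDl ?sumr_ge0// => [j _|].
  exact: sqr_ge0.
by rewrite exprn_gt0// -ltcR rnormE normr_gt0.
Qed.

Let ell2_bilin : bilinear_for *%R (@conjC C \; *%R) ell2_dot.
Proof.
split=> [y|x]; first exact: ell2_dot_linear.
move=> a y y'; rewrite ell2_dotC ell2_dot_linear rmorphD rmorphM/=.
by rewrite -!ell2_dotC.
Qed.

HB.instance Definition _ :=
  bilinear_isBilinear.Build C ell2 ell2 C *%R (@conjC C \; *%R) ell2_dot ell2_bilin.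

Let ell2_herm x y : ell2_dot x y = (-1) ^+ false * (ell2_dot y x)^*.
Proof. by rewrite expr0 mul1r -ell2_dotC. Qed.

HB.instance Definition _ :=
  isHermitianSesquilinear.Build C ell2 false (@conjC C) ell2_dot ell2_herm.

HB.instance Definition _ := isDotProduct.Build C ell2 ell2_dot ell2_dot_gt0.

HB.instance Definition _ := @Lmodule_isNormed.Build C ell2 (dnorm ell2_dot)
  (dnormD ell2_dot) (dnormZ ell2_dot) (@dnorm_eq0 _ _ ell2_dot).

Lemma ell2_normE (x : ell2) : `|x| ^+ 2 = ell2_dot x x.
Proof. exact: dnorm_sqr. Qed.

End ell2.

Section ell2_complete.
Variables (R : realType) (H : hilbertType R).
Local Notation C := R[i].
Local Notation ell2 := (ell2 H).

Lemma ell2_rnorm_sqr (x : ell2) :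
  rnorm x ^+ 2 = limn (series (fun i => rnorm (x i) ^+ 2)).
Proof.
by apply: complexI; rewrite rmorphXn/= rnormE ell2_normE ell2_dotxx.
Qed.

Lemma ell2_series_le (x : ell2) n :
  series (fun i => rnorm (x i) ^+ 2) n <= rnorm x ^+ 2.
Proof. by rewrite ell2_rnorm_sqr ell2_partial_le. Qed.

Lemma ell2_rnorm_le (x : ell2) (e : R) : 0 <= e ->
  (forall n, series (fun i => rnorm (x i) ^+ 2) n <= e ^+ 2) -> rnorm x <= e.
Proof.
move=> e0 h; rewrite -ler_sqr ?nnegrE ?rnorm_ge0// ell2_rnorm_sqr.
by apply: limr_le; [exact: ell2P|exact: nearW].
Qed.

Lemma ell2_coord_le (x : ell2) i : rnorm (x i) <= rnorm x.
Proof.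
rewrite -ler_sqr ?nnegrE ?rnorm_ge0//.
apply: le_trans (ell2_series_le x i.+1).
by rewrite /series/= big_nat_recr//= lerDr sumr_ge0// => j _; exact: sqr_ge0.
Qed.

Lemma ell2BE (x y : ell2) i : (x - y) i = x i - y i.
Proof. by rewrite ell2DE ell2NE. Qed.

Lemma ell2_complete (F : set_system ell2) :
  ProperFilter F -> cauchy F -> cvg F.
Proof.
move=> FF /cauchy_ballP Fc.
have Fi i : cvg ((fun x : ell2 => x i) @ F).
  apply: cauchy_cvg; apply/cauchy_ballP => e e0.
  have [[A B] /= [FA FB] AB] := Fc e e0.
  exists ([set (x : ell2) i | x in A], [set (x : ell2) i | x in B]) => /=.
    split.
      by apply: filterS FA => x Ax; exists x.
    by apply: filterS FB => x Ax; exists x.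
  move=> [_ _] /= [[x Ax <-] [y By <-]].
  have := AB (x, y) (conj Ax By); rewrite /= -!ball_normE/= => xye.
  apply: le_lt_trans xye.
  by rewrite -ell2BE -!rnormE lecR ell2_coord_le.
pose l i := lim ((fun x : ell2 => x i) @ F).
have key (e : R) : 0 < e -> \forall x \near F, forall n,
    series (fun i => rnorm ((x : ell2) i - l i) ^+ 2) n <= e ^+ 2.
  move=> e0; have e0' : 0 < e%:C%C by rewrite ltcR.
  have [[A B] /= [FA FB] AB] := Fc _ e0'.
  apply: filterS FA => x Ax n.
  have h : (fun y : ell2 => series (fun i => rnorm (x i - y i) ^+ 2) n) @ F -->
      series (fun i => rnorm (x i - l i) ^+ 2) n.
    rewrite /series/=; apply: cvg_big => [|i _]; first exact: add_continuous.
    have hi : (fun y : ell2 => rnorm (x i - y i)) @ F --> rnorm (x i - l i).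
      have hd : (fun y : ell2 => x i - y i) @ F --> x i - l i.
        by apply: cvgB; [exact: cvg_cst|exact: Fi].
      by apply: (@cvg_comp _ _ _ _ (@rnorm R H) _ _ _ hd); exact: rnorm_continuous.
    exact: (cvgM hi hi).
  rewrite -(cvg_lim (@Rhausdorff R) h); apply: limr_le; first exact/cvgP/h.
  apply: filterS FB => y By.
  have := AB (x, y) (conj Ax By); rewrite /= -ball_normE/= -rnormE ltcR => xye.
  have /le_trans -> // : series (fun i => rnorm (x i - y i) ^+ 2) n <= rnorm (x - y) ^+ 2.
    have -> : (fun i => rnorm (x i - y i) ^+ 2) =
        (fun i => rnorm ((x - y) i) ^+ 2).
      by apply/funext => i; rewrite ell2BE.
    exact: ell2_series_le.
  by rewrite ler_sqr ?nnegrE ?rnorm_ge0// ltW.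
have [x0 x0l] := filter_ex (key 1 ltr01).
have dl : (fun i => x0 i - l i) \in @sqsummable R H.
  apply/sqsummableP/nondecreasing_is_cvgn.
    by apply: nondecreasing_series => i _ _; exact: sqr_ge0.
  by exists (1 ^+ 2) => _ [n _ <-]; exact: x0l.
have lP : l \in @sqsummable R H.
  have -> : l = (x0 : nat -> H) - (fun i => x0 i - l i).
    by apply/funext => i; rewrite !fctE opprB addrC subrK.
  by rewrite rpredB// ell2_valP.
apply/cvg_ex; exists (Ell2 lP); apply/(@cvgrPdist_le _ _ _ F _ id) => e e0.
have e0' : 0 < complex.Re e by rewrite -ltcR ge0_cReK// ltW.
apply: filterS (key _ e0') => x xl.
rewrite distrC -rnormE -(ge0_cReK (ltW e0)) lecR.
apply: ell2_rnorm_le; first exact: ltW.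
move=> n; have -> : (fun i => rnorm ((x - Ell2 lP) i) ^+ 2) =
    (fun i => rnorm (x i - l i) ^+ 2).
  by apply/funext => i; rewrite ell2BE.
exact: xl.
Qed.

HB.instance Definition _ := Uniform_isComplete.Build ell2 ell2_complete.
HB.instance Definition _ := isHilbert.Build R ell2 (@ell2_normE R H).

End ell2_complete.

Section bounded_operators.
Variables (R : realType) (H K : hilbertType R).
Local Notation C := R[i].

Definition bounded_op : {pred H -> K} :=
  fun T => `[< linear T /\ continuous T >].

Lemma bounded_op_submod_closed : submod_closed bounded_op.
Proof.
split=> [|a S T /asboolP[Sl Sc] /asboolP[Tl Tc]]; apply/asboolP; split.
- by move=> a x y; exact/esym/(etrans (addr0 _) (scaler0 _ _)).
- by move=> x; exact: cvg_cst.
- move=> b x y; have E z : (a *: S + T) z = a *: S z + T z by [].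
  rewrite !E Sl Tl !scalerDr !scalerA [a * b]mulrC.
  by rewrite addrACA.
- move=> x; apply: (@cvgD _ _ _ _ _ (a \*: S) T); last exact: Tc.
  by apply: cvgZr; exact: Sc.
Qed.

HB.instance Definition _ := GRing.isSubmodClosed.Build C (H -> K) bounded_op
  bounded_op_submod_closed.

Record bop := Bop { bop_fun :> H -> K ; _ : bop_fun \in bounded_op }.

HB.instance Definition _ := [isSub for bop_fun].
HB.instance Definition _ := [Choice of bop by <:].
HB.instance Definition _ := [SubChoice_isSubLmodule of bop by <:].

Lemma bop_linear (T : bop) : linear T.
Proof. by case: T => T /= /asboolP[]. Qed.

Lemma bop_continuous (T : bop) : continuous T.
Proof. by case: T => T /= /asboolP[]. Qed.

HB.instance Definition _ (T : bop) :=
  GRing.isLinear.Build C H K _ (bop_fun T) (bop_linear T).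

(* The set of values is bounded above since T is continuous. *)
Definition opnorm (T : bop) : R := sup [set rnorm (T x) | x in [set x | `|x| <= 1]].

End bounded_operators.

Notation "''B' ( H , K )" := (bop H K) (format "''B' ( H ,  K )") : type_scope.

Section composition.
Variables (R : realType) (H K L : hilbertType R).

Lemma bop_id_subproof : (id : H -> H) \in @bounded_op R H H.
Proof. by apply/asboolP; split => // x; exact: cvg_id. Qed.

Definition bop_id : 'B(H, H) := Bop bop_id_subproof.

Lemma bop_comp_subproof (S : 'B(K, L)) (T : 'B(H, K)) :
  S \o T \in @bounded_op R H L.
Proof.
apply/asboolP; split => [a x y|x]; first by rewrite /= !linearP.
by apply: continuous_comp; exact: bop_continuous.
Qed.

Definition bop_comp (S : 'B(K, L)) (T : 'B(H, K)) : 'B(H, L) :=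
  Bop (bop_comp_subproof S T).

End composition.
Arguments bop_id {R H}.

Notation "S \ob T" := (bop_comp S T)
  (at level 50, left associativity, format "S  \ob  T") : ring_scope.

Section operator_spaces.
Variables (R : realType).
Implicit Types H K : hilbertType R.
Local Notation C := R[i].

Definition is_subspace (V : lmodType C) (X : set V) :=
  X 0 /\ forall (a : C) x y, X x -> X y -> X (a *: x + y).

Definition is_adjoint H K (T : 'B(H, K)) (S : 'B(K, H)) :=
  forall x y, hdot (T x) y = hdot x (S y).

Definition adjoints H K (X : set 'B(H, K)) : set 'B(K, H) :=
  [set S | exists2 T, X T & is_adjoint T S].

Definition set_comp H K L (X : set 'B(K, L)) (Y : set 'B(H, K)) :
    set 'B(H, L) :=
  [set T | exists S1 S2, [/\ X S1, Y S2 & T = S1 \ob S2]].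

(* B(H, K) is the dual of the trace class operators from K to H, and its
   weak*-continuous functionals are exactly
   T |-> \sum_n <T x_n, y_n>, for square-summable (x_n) and (y_n). *)
Definition wstar_eval H K (T : 'B(H, K)) :
    prod_topology (fun _ : ell2 H * ell2 K => C^o) :=
  fun p => limn (series (fun n => hdot (T (p.1 n)) (p.2 n) : C^o)).

Definition wstar_closure H K (X : set 'B(H, K)) : set 'B(H, K) :=
  @closure (initial_topology (@wstar_eval H K)) X.

Definition wstar_span H K (X : set 'B(H, K)) : set 'B(H, K) :=
  wstar_closure (smallest (@is_subspace _) X).

Definition TRO H K (M : set 'B(H, K)) :=
  is_subspace M /\ set_comp (set_comp M (adjoints M)) M `<=` M.

Definition weak_TRO_equivalent H1 H2 K1 K2
    (U : set 'B(K1, K2)) (V : set 'B(H1, H2)) :=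
  exists (M1 : set 'B(H1, K1)) (M2 : set 'B(H2, K2)),
    [/\ TRO M1, TRO M2,
        U = wstar_span (set_comp (set_comp M2 V) (adjoints M1)) &
        V = wstar_span (set_comp (set_comp (adjoints M2) U) M1)].

End operator_spaces.

Section subspace_lattices.
Variables (R : realType).
Implicit Types H : hilbertType R.

Definition is_projection H (P : 'B(H, H)) := P \ob P = P /\ is_adjoint P P.

Definition proj_le H (P Q : 'B(H, H)) := Q \ob P = P.

Definition is_proj_sup H (F : set 'B(H, H)) (P : 'B(H, H)) :=
  [/\ is_projection P, forall Q, F Q -> proj_le Q P &
      forall P', is_projection P' -> (forall Q, F Q -> proj_le Q P') ->
        proj_le P P'].

Definition is_proj_inf H (F : set 'B(H, H)) (P : 'B(H, H)) :=
  [/\ is_projection P, forall Q, F Q -> proj_le P Q &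
      forall P', is_projection P' -> (forall Q, F Q -> proj_le P' Q) ->
        proj_le P' P].

Definition subspace_lattice H (L : set 'B(H, H)) :=
  [/\ L `<=` @is_projection H, L 0, L bop_id,
      forall F P, F `<=` L -> is_proj_sup F P -> L P &
      forall F P, F `<=` L -> is_proj_inf F P -> L P].

Definition CSL H (L : set 'B(H, H)) :=
  subspace_lattice L /\ forall P Q, L P -> L Q -> P \ob Q = Q \ob P.

Definition Alg H (L : set 'B(H, H)) : set 'B(H, H) :=
  [set A | forall P, L P -> (bop_id - P) \ob A \ob P = 0].

Definition commutant H (X : set 'B(H, H)) : set 'B(H, H) :=
  [set A | forall B, X B -> A \ob B = B \ob A].

Definition minimal_projection H (N : set 'B(H, H)) (E : 'B(H, H)) :=
  [/\ N E, is_projection E, E <> 0 &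
      forall F, N F -> is_projection F -> proj_le F E -> F = 0 \/ F = E].

Definition totally_atomic H (L : set 'B(H, H)) :=
  is_proj_sup (minimal_projection (commutant (commutant L))) bop_id.

Definition CSL_isomorphic H1 H2 (L1 : set 'B(H1, H1)) (L2 : set 'B(H2, H2)) :=
  exists2 phi : 'B(H1, H1) -> 'B(H2, H2), set_bij L1 L2 phi &
    forall P Q, L1 P -> L1 Q -> (proj_le P Q <-> proj_le (phi P) (phi Q)).

End subspace_lattices.

Section hyperreflexivity.
Variables (R : realType).
Implicit Types H K : hilbertType R.
Local Notation C := R[i].

Definition op_dist H K (T : 'B(H, K)) (X : set 'B(H, K)) : R :=
  inf [set opnorm (T - S) | S in X].

(* Since sup set0 = 0, refl_seminorm X T = 0 when X annihilates no pair of unit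
   vectors, as for X = B(H, K); otherwise the set is bounded by opnorm T. *)
Definition refl_seminorm H K (X : set 'B(H, K)) (T : 'B(H, K)) : R :=
  sup [set r | exists xi eta, [/\ `|xi| = 1, `|eta| = 1,
    forall S, X S -> hdot (S xi) eta = 0 & r = rnorm (hdot (T xi) eta : C)]].

Definition hyperreflexive H K (X : set 'B(H, K)) :=
  exists2 k : R, 0 < k & forall T, op_dist T X <= k * refl_seminorm X T.

(* The quotients have a positive denominator when X is norm closed and
   hyperreflexive. *)
Definition hyperreflexivity_const H K (X : set 'B(H, K)) : \bar R :=
  if `[< X = setT >] then 1%E
  else if `[< hyperreflexive X >] then
    ereal_sup [set (op_dist T X / refl_seminorm X T)%:E | T in ~` X]
  else +oo%E.

(* M_\infty^w(X): the operators on H^\infty = ell2 H given by a matrix with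
   entries in X whose finite submatrices, with rows I and columns J, have
   uniformly bounded norm. *)
Definition matrix_space H K (X : set 'B(H, K)) : set 'B(ell2 H, ell2 K) :=
  [set T : 'B(ell2 H, ell2 K) | exists A : nat -> nat -> 'B(H, K),
    [/\ forall i j, X (A i j),
        exists M : R, forall (I J : seq nat) (x : nat -> H),
          uniq I -> uniq J ->
          \sum_(i <- I) rnorm (\sum_(j <- J) A i j (x j)) ^+ 2 <=
            M ^+ 2 * \sum_(j <- J) rnorm (x j) ^+ 2 &
        forall (x : ell2 H) i, series (fun j => A i j (x j)) @ \oo --> T x i]].

Definition complete_hyperreflexivity_const H K (X : set 'B(H, K)) : \bar R :=
  hyperreflexivity_const (matrix_space X).

End hyperreflexivity.

Definition separable_space (T : topologicalType) :=
  exists2 D : set T, countable D & dense D.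

(* Main.v *)
From HB Require Import structures.
Require Import Defs.
From mathcomp Require Import all_boot all_order all_algebra complex.
From mathcomp Require Import boolp classical_sets functions cardinality reals.
From mathcomp Require Import ereal topology normedtype sequences.
From mathcomp Require Import ring lra.

Set Implicit Arguments.
Unset Strict Implicit.
Unset Printing Implicit Defensive.

Import Order.TTheory GRing.Theory Num.Theory Num.Def.
Import numFieldNormedType.Exports.

Local Open Scope classical_set_scope.
Local Open Scope ring_scope.

(** Let phi be the order isomorphism from L1 onto L2. Since L1 is commutative,
    every P in L1 either fixes or annihilates the range of an atom e of the
    von Neumann algebra of L1. Put Pe = inf {P in L1 : P e = e} and
    Qe = sup {P in L1 : P e = 0}. Then Pe fixes the range of e and Qe kills it,
    so Pe is not below Qe; hence phi Pe is not below phi Qe, and some unit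
    vector u lies in the range of phi Pe and in the kernel of phi Qe. By
    monotonicity, phi P fixes u when P fixes e, and kills u when P kills e
    ([atomic_vector_transfer]). The atoms are pairwise orthogonal with supremum
    the identity, so H1 has an orthonormal basis (b_n) of vectors in ranges of
    atoms, and it is countable because H1 is separable. Each b_n has its
    partner u_n in H2 ([intertwining_sequences]): the rank one operators
    rank1 u_n b_n and rank1 b_n u_n intertwine P with phi P. Both halves of the
    theorem follow from the existence of such a pair of sequences for phi and
    of another one for the inverse of phi.

    Weak TRO equivalence. The operators T with T (phi P) = P T for all P in L1
    form a TRO M, and M Alg(L2) M* is contained in Alg(L1), which is weak*
    closed ([wstar_span_compression]). Conversely, if Q_n is the projection onto
    the span of the b_k with k < n, then A in Alg(L1) is the weak* limit of
    Q_n A Q_n, a combination of the operators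
      rank1 b_i b_j = rank1 b_i u_i o rank1 u_i u_j o rank1 u_j b_j
    with coefficients <A b_j, b_i>; when such a coefficient is nonzero, every
    phi P that fixes u_j fixes u_i, so that rank1 u_i u_j is in Alg(L2)
    ([Alg_sub_wstar_span]).

    Complete hyperreflexivity constants. The matrix space of Alg(L) consists of
    the operators on the infinite direct sum that leave the range of each
    ampliation of a P in L invariant ([matrix_space_AlgP]). Spreading the
    Fourier coefficients <x_n, b_k> u_k of a vector (x_n) over the components
    coded by the pairs (k, n) is an isometry W which intertwines the ampliations
    of P and phi P ([exists_isometry]). Passing from T to W T W* does not
    decrease the distance to the matrix space and does not increase the
    seminorm, so that k_c(Alg L1) <= k_c(Alg L2)
    ([hyperreflexivity_const_le]), and the inverse of phi gives the reverse
    inequality. One isometry in each direction does the work of a unitary, and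
    the dimensions of corresponding atoms do not have to be matched. *)

(** * Inner products and convergence *)

Section hilbert_basics.
Variables (R : realType) (H : hilbertType R).
Local Notation C := R[i].
Implicit Types (x y z l : H) (u : nat -> H).

Lemma hdotC x y : hdot x y = (hdot y x)^*.
Proof. exact: dotC. Qed.

Lemma hdotDl x y z : hdot (x + y) z = hdot x z + hdot y z.
Proof. exact: linearDl. Qed.
Lemma hdotDr x y z : hdot x (y + z) = hdot x y + hdot x z.
Proof. exact: linearDr. Qed.
Lemma hdotBl x y z : hdot (x - y) z = hdot x z - hdot y z.
Proof. exact: linearBl. Qed.
Lemma hdotBr x y z : hdot x (y - z) = hdot x y - hdot x z.
Proof. exact: linearBr. Qed.
Lemma hdotZl (a : C) x y : hdot (a *: x) y = a * hdot x y.
Proof. exact: linearZl_LR. Qed.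
Lemma hdotZr (a : C) x y : hdot x (a *: y) = a^* * hdot x y.
Proof. exact: linearZr_LR. Qed.
Lemma hdot0l y : hdot (0 : H) y = 0.
Proof. exact: linear0l. Qed.
Lemma hdot0r x : hdot x (0 : H) = 0.
Proof. exact: linear0r. Qed.
Lemma hdot_suml I (s : seq I) (F : I -> H) y :
  hdot (\sum_(i <- s) F i) y = \sum_(i <- s) hdot (F i) y.
Proof. exact: (linear_sum (applyr (@hdot R H) y)). Qed.
Lemma hdot_sumr I (s : seq I) (F : I -> H) x :
  hdot x (\sum_(i <- s) F i) = \sum_(i <- s) hdot x (F i).
Proof. by rewrite hdotC hdot_suml rmorph_sum; apply: eq_bigr => i _; rewrite [RHS]hdotC. Qed.

Lemma Re_hdotC x y : complex.Re (hdot x y) = complex.Re (hdot y x).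
Proof. by rewrite hdotC; case: (hdot y x). Qed.

Lemma rnorm_sqr x : rnorm x ^+ 2 = complex.Re (hdot x x).
Proof. by rewrite hdot_rnorm. Qed.

Lemma sqr_rnormD x y :
  rnorm (x + y) ^+ 2 = rnorm x ^+ 2 + rnorm y ^+ 2 + complex.Re (hdot x y) *+ 2.
Proof.
rewrite !rnorm_sqr hdotDl !hdotDr !raddfD/= (Re_hdotC y x).
by rewrite mulr2n; lra.
Qed.

Lemma sqr_rnormB x y :
  rnorm (x - y) ^+ 2 = rnorm x ^+ 2 + rnorm y ^+ 2 - complex.Re (hdot x y) *+ 2.
Proof.
rewrite !rnorm_sqr hdotBl !hdotBr !raddfB/= (Re_hdotC y x).
by rewrite mulr2n; lra.
Qed.

Lemma parallelogram x y :
  rnorm (x + y) ^+ 2 + rnorm (x - y) ^+ 2 = (rnorm x ^+ 2 + rnorm y ^+ 2) *+ 2.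
Proof. by rewrite sqr_rnormD sqr_rnormB !mulr2n; lra. Qed.

Lemma rnorm_eq0 x : rnorm x = 0 -> x = 0.
Proof. by move=> x0; apply/eqP; rewrite -normr_eq0 -rnormE x0. Qed.

Lemma rnorm_gt0 x : x <> 0 -> 0 < rnorm x.
Proof. by move=> x0; rewrite lt_neqAle rnorm_ge0 andbT; apply/eqP => /esym/rnorm_eq0. Qed.

Lemma hdotxx_eq0 x : hdot x x = 0 -> x = 0.
Proof.
by move=> xx; apply: rnorm_eq0; apply/eqP; rewrite -sqrf_eq0 rnorm_sqr xx.
Qed.

Lemma hdot_eq x x' : (forall y, hdot x y = hdot x' y) -> x = x'.
Proof.
move=> xx'; apply/eqP; rewrite -subr_eq0; apply/eqP/hdotxx_eq0.
by rewrite hdotBl xx' subrr.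
Qed.

Lemma hdot_CauchySchwarz x y : rnorm (hdot x y : C) <= rnorm x * rnorm y.
Proof.
rewrite -ler_sqr ?nnegrE ?mulr_ge0 ?rnorm_ge0// exprMn -lecR.
rewrite !(rmorphXn, rmorphM)/= !rnormE.
by have := dot_CauchySchwarz (@hdot R H) x y; rewrite !hdot_norm.
Qed.

Lemma Re_le_rnorm (a : C) : complex.Re a <= rnorm a.
Proof.
rewrite /rnorm normc_def/=; case: a => a b /=.
by rewrite (le_trans (ler_norm a))// -sqrtr_sqr ler_wsqrtr// lerDl sqr_ge0.
Qed.

Lemma rnormN x : rnorm (- x) = rnorm x.
Proof. by rewrite /rnorm normrN. Qed.

Lemma rnormC x y : rnorm (x - y) = rnorm (y - x).
Proof. by rewrite -rnormN opprB. Qed.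

Lemma cvg_rnormP u l :
  u @ \oo --> l <-> forall e : R, 0 < e -> exists N, forall n, (N <= n)%N -> rnorm (u n - l) <= e.
Proof.
split=> [/cvgrPdist_lt h e e0|h].
  have [|N _ hN] := h e%:C%C; first by rewrite ltcR.
  exists N => n /hN /=; rewrite -rnormE ltcR rnormC; exact: ltW.
apply/cvgrPdist_le => e e0.
have e0' : 0 < complex.Re e by rewrite -ltcR ge0_cReK// ltW.
have [N hN] := h _ e0'; exists N => // n /= /hN.
by rewrite -[X in _ -> _ <= X](ge0_cReK (ltW e0)) -rnormE lecR rnormC.
Qed.

Lemma cauchy_rnorm u :
  (forall e : R, 0 < e -> exists N, forall m n, (N <= m)%N -> (N <= n)%N -> rnorm (u m - u n) <= e) ->
  exists l : H, u @ \oo --> l.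
Proof.
move=> h; have : cvgn u; last by move=> /cvg_ex.
apply: cauchy_cvg; apply/cauchy_ballP => e e0.
have e0' : 0 < complex.Re e / 2 by rewrite divr_gt0// -ltcR ge0_cReK// ltW.
have [N hN] := h _ e0'.
exists (u @` [set n | (N <= n)%N], u @` [set n | (N <= n)%N]) => /=.
  by split; exists N => // n Nn; exists n.
move=> [_ _] /= [[m Nm <-] [n Nn <-]]; rewrite -ball_normE /= -rnormE.
rewrite -(ge0_cReK (ltW e0)) ltcR (le_lt_trans (hN _ _ Nm Nn))//.
by move: e0'; lra.
Qed.

Lemma cvg_rnorm u l : u @ \oo --> l -> rnorm (u n) @[n --> \oo] --> rnorm l.
Proof. by move=> ul; apply: cvg_comp; [exact: ul|exact: rnorm_continuous]. Qed.

Lemma cvg_unique_hilbert u l l' : u @ \oo --> l -> u @ \oo --> l' -> l = l'.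
Proof. exact: (cvg_unique (@norm_hausdorff _ _)). Qed.

Lemma cvg_hdotl u l y : u @ \oo --> l ->
  (fun n => hdot (u n) y : C^o) @ \oo --> (hdot l y : C^o).
Proof.
move=> /cvg_rnormP ul; apply/cvgrPdist_le => e e0.
have e0' : 0 < complex.Re e by rewrite -ltcR ge0_cReK// ltW.
have y0 : 0 < rnorm y + 1 by rewrite ltr_wpDl ?rnorm_ge0.
have [N hN] := ul (complex.Re e / (rnorm y + 1)) (divr_gt0 e0' y0).
exists N => // n /= /hN h; rewrite -hdotBl -rnormE -(ge0_cReK (ltW e0)) lecR.
apply: le_trans (hdot_CauchySchwarz _ _) _; rewrite rnormC.
apply: le_trans (_ : _ <= complex.Re e / (rnorm y + 1) * (rnorm y + 1)) _; last by rewrite divfK ?gt_eqF.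
by apply: ler_pM; rewrite ?rnorm_ge0// lerDl.
Qed.

End hilbert_basics.

(** * Bounded operators and the projection theorem *)

Section bounded_operators.
Variables (R : realType).
Local Notation C := R[i].
Implicit Types (H K : hilbertType R).

Lemma rnormR (a : R) : rnorm (a%:C%C : C) = `|a|.
Proof. by rewrite /rnorm normc_def/= expr0n addr0 sqrtr_sqr. Qed.

Lemma rnorm_normalize H (x : H) : x <> 0 -> rnorm (((rnorm x)^-1%:C%C : C) *: x) = 1.
Proof.
move=> /rnorm_gt0 x0.
by rewrite rnormZ rnormR ger0_norm ?invr_ge0 ?rnorm_ge0// mulVf ?gt_eqF.
Qed.

Lemma exists_bop H K (f : H -> K) (M : R) : linear f ->
  (forall x, rnorm (f x) <= M * rnorm x) -> exists T : 'B(H, K), forall x, T x = f x.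
Proof.
move=> fl fM; suff fB : f \in @bounded_op R H K by exists (Bop fB).
apply/asboolP; split => // x; apply/cvgrPdist_le => e e0.
have e0' : 0 < complex.Re e by rewrite -ltcR ge0_cReK// ltW.
have M0 : 0 < `|M| + 1 by rewrite ltr_wpDl.
have fB a b : f a - f b = f (a - b).
  by have := fl (-1) b a; rewrite !scaleN1r addrC => <-; rewrite addrC.
near=> y; rewrite fB -(ge0_cReK (ltW e0)) -rnormE lecR (le_trans (fM _))//.
apply: (@le_trans _ _ ((`|M| + 1) * rnorm (x - y))).
  by apply: ler_wpM2r; rewrite ?rnorm_ge0// (le_trans (ler_norm _))// lerDl.
rewrite mulrC -ler_pdivlMr// -lecR rnormE.
near: y; apply: cvgr_dist_le; first exact: cvg_id.
by rewrite ltcR divr_gt0.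
Unshelve. all: by end_near. Qed.

Lemma bop_bounded H K (T : 'B(H, K)) :
  exists2 M : R, 0 <= M & forall x, rnorm (T x) <= M * rnorm x.
Proof.
have /cvgrPdist_lt/(_ 1 ltr01) := @bop_continuous _ _ _ T 0.
rewrite linear0 => /nbhs_ballP[d /= d0 hd].
have d0' : 0 < complex.Re d by rewrite -ltcR ge0_cReK// ltW.
have [s s0 sd] : exists2 s, 0 < s & s < complex.Re d.
  by exists (complex.Re d / 2); [rewrite divr_gt0|move: d0'; lra].
exists s^-1; first by rewrite invr_ge0 ltW.
move=> x; have [->|x0] := eqVneq x 0.
  by rewrite linear0 !rnorm0 mulr0.
have xp : 0 < rnorm x by apply: rnorm_gt0; exact/eqP.
have -> : x = ((rnorm x / s)%:C%C : C) *: ((s / rnorm x)%:C%C *: x).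
  by rewrite scalerA -rmorphM/= mulrA divfK ?gt_eqF// divff ?scale1r ?gt_eqF.
set z := _ *: x.
have zs : rnorm z = s.
  by rewrite rnormZ rnormR ger0_norm ?divr_ge0 ?ltW// divfK// gt_eqF.
have : ball (0 : H) d z.
  by rewrite -ball_normE /= sub0r normrN -rnormE zs -(ge0_cReK (ltW d0)) ltcR.
move=> /hd /=; rewrite sub0r normrN -rnormE ltcR => h.
have xs0 : 0 <= rnorm x / s by rewrite divr_ge0 ?(ltW s0) ?(ltW xp).
clearbody z; rewrite linearZ !rnormZ rnormR (ger0_norm xs0) zs.
by rewrite divfK ?gt_eqF// [leRHS]mulrC ler_piMr// ltW.
Qed.

Lemma bop_eq H K (S T : 'B(H, K)) : (forall x, S x = T x) -> S = T.
Proof. by move=> ST; apply/val_inj/funext. Qed.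

Lemma bopDE H K (S T : 'B(H, K)) x : (S + T) x = S x + T x.
Proof. by rewrite -[LHS]/((\val (S + T)) x) raddfD. Qed.
Lemma bopNE H K (S : 'B(H, K)) x : (- S) x = - S x.
Proof. by rewrite -[LHS]/((\val (- S)) x) raddfN. Qed.
Lemma bopBE H K (S T : 'B(H, K)) x : (S - T) x = S x - T x.
Proof. by rewrite bopDE bopNE. Qed.
Lemma bopZE H K (a : C) (S : 'B(H, K)) x : (a *: S) x = a *: S x.
Proof. by rewrite -[LHS]/((\val (a *: S)) x) linearZ. Qed.
Lemma bop0E H K x : (0 : 'B(H, K)) x = 0.
Proof. by []. Qed.
Lemma bop_sumE H K I (s : seq I) (F : I -> 'B(H, K)) x :
  (\sum_(i <- s) F i) x = \sum_(i <- s) F i x.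
Proof. by elim/big_rec2 : _ => // i y T _ <-; rewrite bopDE. Qed.

Lemma bop0 H K (T : 'B(H, K)) : T 0 = 0.
Proof. exact: linear0. Qed.
Lemma bopD H K (T : 'B(H, K)) x y : T (x + y) = T x + T y.
Proof. exact: linearD. Qed.
Lemma bopB H K (T : 'B(H, K)) x y : T (x - y) = T x - T y.
Proof. exact: linearB. Qed.
Lemma bopZ H K (T : 'B(H, K)) (a : C) x : T (a *: x) = a *: T x.
Proof. exact: linearZ. Qed.
Lemma bop_sum H K (T : 'B(H, K)) I (s : seq I) (F : I -> H) :
  T (\sum_(i <- s) F i) = \sum_(i <- s) T (F i).
Proof. exact: linear_sum. Qed.

Lemma cvg_bop H K (T : 'B(H, K)) (u : nat -> H) (l : H) :
  u @ \oo --> l -> (fun n => T (u n)) @ \oo --> T l.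
Proof. by move=> ul; apply: continuous_cvg; [exact: bop_continuous|exact: ul]. Qed.

Section closest_point.
Variables (H : hilbertType R) (N : set H).
Hypotheses (N_sub : is_subspace N) (N_closed : closed N).

Let N0 : N 0. Proof. by case: N_sub. Qed.
Let NZ (a : C) x : N x -> N (a *: x).
Proof. by move=> Nx; rewrite -[_ *: _]addr0; apply: N_sub.2. Qed.
Let ND x y : N x -> N y -> N (x + y).
Proof. by move=> Nx Ny; rewrite -[x]scale1r; apply: N_sub.2. Qed.
Let NB x y : N x -> N y -> N (x - y).
Proof. by move=> Nx Ny; rewrite -scaleN1r; apply: ND => //; apply: NZ. Qed.

(** Minimizing sequences for the distance to N are Cauchy by the parallelogram
    law, since the midpoint of two points of N stays in N. *)
Lemma exists_closest (x : H) :
  exists2 z, N z & forall y, N y -> rnorm (x - z) <= rnorm (x - y).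
Proof.
pose D := [set rnorm (x - y) ^+ 2 | y in N].
have D0 : D !=set0 by exists (rnorm (x - 0) ^+ 2), 0.
have Dlb : lbound D 0 by move=> _ [y _ <-]; exact: sqr_ge0.
have Dinf : has_inf D by split => //; exists 0.
have dle y : N y -> inf D <= rnorm (x - y) ^+ 2.
  by move=> Ny; apply: ge_inf; [exists 0|exists y].
have /choice[u uP] : forall n, exists y, N y /\ rnorm (x - y) ^+ 2 < inf D + n.+1%:R^-1.
  move=> n; have n0 : 0 < n.+1%:R^-1 :> R by rewrite invr_gt0.
  by have [_ [y Ny <-] h] := inf_adherent n0 Dinf; exists y.
have uu m n : rnorm (u m - u n) ^+ 2 <= (m.+1%:R^-1 + n.+1%:R^-1) *+ 2.
  have := parallelogram (x - u m) (x - u n).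
  rewrite [x - u m - _](_ : _ = u n - u m); last by rewrite opprB addrC addrA subrK.
  rewrite [x - u m + _](_ : _ = (2 : C) *: (x - (2^-1 : C) *: (u m + u n))); last first.
    rewrite scalerBr scalerA divff ?pnatr_eq0// scale1r scaler_nat mulr2n.
    by rewrite addrACA opprD.
  have := dle _ (NZ 2^-1 (ND (uP m).1 (uP n).1)).
  have := (uP m).2; have := (uP n).2.
  rewrite [rnorm (u m - u n)]rnormC rnormZ exprMn.
  rewrite (_ : rnorm (2 : C) = 2); last first.
    by rewrite -(rmorph_nat (@real_complex R)) rnormR ger0_norm.
  move: (rnorm (x - u m) ^+ 2) (rnorm (x - u n) ^+ 2) (rnorm (u n - u m) ^+ 2)
    (rnorm (x - _) ^+ 2) (inf D) (m.+1%:R^-1) (n.+1%:R^-1) => a b c d i p q.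
  by rewrite expr2; lra.
have [z uz] : exists z : H, u @ \oo --> z.
  apply: cauchy_rnorm => e e0.
  have [k ke] : exists k : nat, k.+1%:R^-1 <= e ^+ 2 / 4.
    have e2 : 0 < e ^+ 2 / 4 by rewrite divr_gt0// exprn_gt0.
    exists (Num.truncn (e ^+ 2 / 4)^-1); rewrite -[leRHS]invrK lef_pV2 ?posrE ?invr_gt0//.
    by apply: ltW; apply: truncnS_gt.
  exists k => m n km kn; rewrite -ler_sqr ?nnegrE ?rnorm_ge0 ?(ltW e0)//.
  apply: le_trans (uu m n) _.
  have h j : (k <= j)%N -> j.+1%:R^-1 <= e ^+ 2 / 4.
    by move=> kj; apply: le_trans ke; rewrite lef_pV2 ?posrE// ler_nat.
  by have := h _ km; have := h _ kn; rewrite mulr2n; move: m.+1%:R^-1 n.+1%:R^-1 (e ^+ 2) => p q r; lra.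
have Nz : N z.
  apply: (closed_cvg N N_closed _ _ uz).
  by apply: nearW => n; exact: (uP n).1.
exists z => // y Ny; rewrite -ler_sqr ?nnegrE ?rnorm_ge0//.
apply: le_trans (dle _ Ny).
have c1 : (fun n => rnorm (x - u n) ^+ 2) @ \oo --> rnorm (x - z) ^+ 2.
  have c : (fun n => rnorm (x - u n)) @ \oo --> rnorm (x - z).
    by apply: cvg_rnorm; apply: cvgB => //; exact: cvg_cst.
  by rewrite expr2; under eq_fun do rewrite expr2; exact: cvgM.
have c2 : (fun n => inf D + n.+1%:R^-1) @ \oo --> inf D.
  rewrite -[X in _ --> X]addr0; apply: cvgD; first exact: cvg_cst.
  exact: cvg_harmonic.
apply: (ler_cvg_to c1 c2); apply: nearW => n; exact/ltW/(uP n).2.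
Qed.

(** The difference of x and its closest point z in N is orthogonal to each y in N:
    otherwise adding a small multiple of <x - z, y> y to z would bring it closer
    to x. *)
Lemma exists_orthogonal_projection : exists P : 'B(H, H),
  [/\ is_projection P, forall x, N (P x) & forall x y, N y -> hdot (x - P x) y = 0].
Proof.
have key x : exists z, N z /\ forall y, N y -> hdot (x - z) y = 0.
  have [z Nz zmin] := exists_closest x; exists z; split => // y Ny.
  apply/eqP; rewrite -normr_eq0 -rnormE; apply/eqP; congr (_%:C%C).
  pose a : C := hdot (x - z) y; rewrite -/a.
  (* any t with 0 < t * |y|^2 < 2 contradicts minimality when a is nonzero *)
  pose t : R := (rnorm y ^+ 2 + 1)^-1.
  have t0 : 0 < t by rewrite invr_gt0 ltr_wpDl ?sqr_ge0.
  have := zmin (z + (t%:C%C * a) *: y) (ND Nz (NZ _ Ny)).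
  rewrite -ler_sqr ?nnegrE ?rnorm_ge0// opprD addrA [leRHS]sqr_rnormB hdotZr rnormZ.
  have -> : complex.Re ((t%:C%C * a)^* * hdot (x - z) y) = t * rnorm a ^+ 2.
    rewrite rmorphM/= -/a -mulrA [a^* * a]mulrC -normCK -rnormE.
    by rewrite conj_Creal ?realE ?lecR ?(ltW t0)// -rmorphXn -rmorphM.
  have -> : rnorm (t%:C%C * a : C) = t * rnorm a.
    have := rnormZ t%:C%C (a : C^o); rewrite rnormR ger0_norm ?(ltW t0)//.
  have ty : t * rnorm y ^+ 2 <= 1.
    by rewrite /t mulrC ler_pdivrMr ?mul1r ?lerDl// ltr_wpDl ?sqr_ge0.
  move=> h; apply/eqP; rewrite -sqrf_eq0 eq_le sqr_ge0 andbT.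
  have : 0 <= t * rnorm a ^+ 2 * (t * rnorm y ^+ 2 - 2).
    by move: h; rewrite mulr2n !exprMn; set A := rnorm a ^+ 2; set B := rnorm y ^+ 2; set X := rnorm (x - z) ^+ 2; nra.
  rewrite nmulr_lge0; last by move: ty; lra.
  by rewrite pmulr_rle0.
have [P PP] := choice key.
have uni x z : N z -> (forall y, N y -> hdot (x - z) y = 0) -> P x = z.
  move=> Nz zP; apply/eqP; rewrite -subr_eq0; apply/eqP/hdotxx_eq0.
  have Nzz : N (P x - z) by apply: NB => //; exact: (PP x).1.
  have E : P x - z = (x - z) - (x - P x) by rewrite opprB [RHS]addrC addrA subrK.
  by rewrite [X in hdot X _]E hdotBl zP// (PP x).2// subrr.
have Pl : linear P.
  move=> a x y; apply: uni; first by apply: ND; [apply: NZ|]; exact: (PP _).1.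
  move=> w Nw; rewrite opprD addrACA -scalerBr hdotDl hdotZl.
  by rewrite !(PP _).2// mulr0 addr0.
have [T TP] : exists T : 'B(H, H), forall x, T x = P x.
  apply: (@exists_bop H H P 1 Pl) => x; rewrite mul1r.
  rewrite -ler_sqr ?nnegrE ?rnorm_ge0// -[x in leRHS](subrK (P x)) sqr_rnormD.
  by rewrite ((PP x).2 _ (PP x).1) /= mul0rn addr0 lerDr sqr_ge0.
exists T; split.
- split; first apply: bop_eq => x /=.
    rewrite !TP; apply: uni => [|y Ny]; first exact: (PP x).1.
    by rewrite subrr hdot0l.
  move=> x y; rewrite !TP -[x in RHS](subrK (P x)) hdotDl ((PP x).2 _ (PP y).1) add0r.
  rewrite -[y in LHS](subrK (P y)) hdotDr [X in X + _]hdotC ((PP y).2 _ (PP x).1).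
  by rewrite rmorph0 add0r.
- by move=> x; rewrite TP; exact: (PP x).1.
- by move=> x y Ny; rewrite TP; exact: (PP x).2.
Qed.

End closest_point.

End bounded_operators.

(** * Riesz representation and adjoints *)

Section riesz.
Variables (R : realType).
Local Notation C := R[i].
Implicit Types (H K : hilbertType R).

Lemma ker_subspace H (V : lmodType C) (f : H -> V) :
  linear f -> is_subspace [set x | f x = 0].
Proof.
move=> fl; split => /= [|a x y fx fy]; last by rewrite fl fx fy scaler0 addr0.
by have := fl (-1) 0 0; rewrite scaler0 addr0 scaleN1r addNr.
Qed.

(** Stated for an arbitrary normed codomain, so that it serves both bounded
    operators and the scalar functionals of the Riesz theorem. *)
Lemma ker_closed H (V : normedModType C) (f : H -> V) (M : R) : linear f ->
  (forall x, rnorm (f x) <= M * rnorm x) -> closed [set x | f x = 0].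
Proof.
move=> fl fM x clx /=; apply/eqP; rewrite -normr_eq0 -rnormE.
suff h : rnorm (f x) <= 0.
  by rewrite (_ : rnorm (f x) = 0)//; apply/eqP; rewrite eq_le h rnorm_ge0.
apply/ler_addgt0Pl => e e0; rewrite addr0.
have M0 : 0 < `|M| + 1 by rewrite ltr_wpDl.
have d0 : (0 : C) < (e / (`|M| + 1))%:C%C by rewrite ltcR divr_gt0.
have [y [/= fy]] := clx _ (nbhsx_ballx x _ d0).
rewrite -ball_normE /= -rnormE ltcR ltr_pdivlMr// => yx.
have -> : f x = f (x - y).
  by have := fl (-1) y x; rewrite !scaleN1r fy oppr0 add0r addrC => ->.
apply: le_trans (fM _) _; rewrite mulrC; apply: le_trans (ltW yx).
by apply: ler_wpM2l; rewrite ?rnorm_ge0// (le_trans (ler_norm _))// lerDl.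
Qed.

(** Infima and suprema of families of projections are both obtained from such
    projections onto common kernels. *)
Lemma exists_projection_onto_ker H K (F : set 'B(H, K)) :
  exists P : 'B(H, H), is_projection P /\
    forall x, P x = x <-> forall T, F T -> T x = 0.
Proof.
pose N := \bigcap_(T in F) [set x : H | T x = 0].
have Ns : is_subspace N.
  split=> [T FT|a x y Nx Ny T FT] /=; first exact: bop0.
  by rewrite bop_linear (Nx _ FT : T x = 0) (Ny _ FT : T y = 0) scaler0 addr0.
have Nc : closed N.
  apply: closed_bigI => T FT; have [M _ MT] := bop_bounded T.
  exact: (ker_closed (bop_linear T) MT).
have [P [Pp PN Po]] := exists_orthogonal_projection Ns Nc.
exists P; split => // x; split => [<- T FT|Nx]; first exact: PN.
apply/esym/eqP; rewrite -subr_eq0; apply/eqP/hdotxx_eq0.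
have xP : N (x - P x).
  by rewrite addrC -scaleN1r; apply: Ns.2.
exact: Po.
Qed.

Lemma hdot_eqr H (z z' : H) : (forall x, hdot x z = hdot x z') -> z = z'.
Proof. by move=> h; apply: hdot_eq => y; rewrite hdotC h -hdotC. Qed.

(** Let e be orthogonal to the kernel of f with f e <> 0. For every w the vector
    f w *: e - f e *: w is in the kernel, hence orthogonal to e, and this
    determines f w from <w, e>. *)
Lemma riesz H (f : H -> C) (M : R) : (forall a x y, f (a *: x + y) = a * f x + f y) ->
  (forall x, rnorm (f x : C) <= M * rnorm x) -> exists z, forall x, f x = hdot x z.
Proof.
move=> fl fM; have fl' : linear (f : H -> C^o) by [].
have Ns := ker_subspace fl'; have Nc := @ker_closed H C^o f M fl' fM.
have [P [_ PN Po]] := exists_orthogonal_projection Ns Nc.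
have [[x fx]|/forallNP f0] := pselect (exists x, f x <> 0); last first.
  by exists 0 => x; rewrite hdot0r; exact: contrapT.
pose e := x - P x.
have fe : f e <> 0.
  have := fl (-1) (P x) x; rewrite (_ : f (P x) = 0) ?mulr0 ?add0r; last exact: PN.
  by rewrite addrC scaleN1r /e => ->.
have ee : hdot e e != 0.
  apply/eqP => /hdotxx_eq0 e0; apply: fe; rewrite e0.
  by have := fl (-1) 0 0; rewrite scaler0 addr0 mulN1r addNr.
exists ((f e / hdot e e)^* *: e) => w; rewrite hdotZr conjCK.
have /Po : [set x | f x = 0] (f w *: e + (- f e) *: w).
  rewrite /= fl; have := fl (- f e) w 0; rewrite addr0 => ->.
  have -> : f 0 = 0 by have := fl (-1) 0 0; rewrite scaler0 addr0 mulN1r addNr.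
  by ring.
move=> /(_ x); rewrite -/e => /(congr1 conjC); rewrite -hdotC rmorph0.
rewrite hdotDl !hdotZl mulNr => /eqP; rewrite subr_eq0 => /eqP h.
by rewrite mulrAC -h mulfK.
Qed.

Lemma exists_adjoint H K (T : 'B(H, K)) : exists S, is_adjoint T S.
Proof.
have [M M0 MT] := bop_bounded T.
have /choice[S SP] : forall y, exists z, forall x, hdot (T x) y = hdot x z.
  move=> y; apply: (@riesz H _ (M * rnorm y)) => [a x x'|x].
    by rewrite bop_linear hdotDl hdotZl.
  apply: le_trans (hdot_CauchySchwarz _ _) _.
  by rewrite mulrAC ler_wpM2r ?rnorm_ge0.
have Sl : linear S.
  by move=> a y y'; apply: hdot_eqr => x; rewrite -SP !(hdotDr, hdotZr) -!SP.
have SM y : rnorm (S y) <= M * rnorm y.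
  have [->|Sy] := pselect (S y = 0); first by rewrite rnorm0 mulr_ge0 ?rnorm_ge0.
  rewrite -(ler_pM2r (rnorm_gt0 Sy)) -expr2 rnorm_sqr -SP mulrAC.
  apply: le_trans (Re_le_rnorm _) _; apply: le_trans (hdot_CauchySchwarz _ _) _.
  by rewrite ler_wpM2r ?rnorm_ge0.
by have [S' S'E] := exists_bop Sl SM; exists S' => x y; rewrite S'E SP.
Qed.

Lemma is_adjointC H K (T : 'B(H, K)) S : is_adjoint T S -> is_adjoint S T.
Proof. by move=> TS x y; rewrite hdotC -TS -hdotC. Qed.

Lemma is_adjoint_unique H K (T : 'B(H, K)) S S' :
  is_adjoint T S -> is_adjoint T S' -> S = S'.
Proof. by move=> h h'; apply: bop_eq => y; apply: hdot_eqr => x; rewrite -h h'. Qed.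

Lemma is_adjoint_comp H K L (T : 'B(H, K)) (T' : 'B(K, L)) S S' :
  is_adjoint T S -> is_adjoint T' S' -> is_adjoint (T' \ob T) (S \ob S').
Proof. by move=> h h' x y /=; rewrite h' h. Qed.

End riesz.

(** * Orthonormal sequences *)

Section orthonormal.
Variables (R : realType) (H : hilbertType R).
Local Notation C := R[i].
Implicit Types (x y : H) (b : nat -> H).

(** Zero terms are allowed, so that bases of finite-dimensional spaces can also
    be indexed by nat. *)
Definition orthonormal_seq b :=
  (forall n, b n = 0 \/ rnorm (b n) = 1) /\
  (forall m n, m != n -> hdot (b m) (b n) = 0).

Definition total_seq b := forall x, (forall n, hdot x (b n) = 0) -> x = 0.

Lemma exists_maximal_orthonormal (S : set H) : exists B : set H,
  [/\ B `<=` S, forall x, B x -> rnorm x = 1,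
      forall x y, B x -> B y -> x <> y -> hdot x y = 0 &
      forall x, S x -> rnorm x = 1 -> exists2 y, B y & hdot x y <> 0].
Proof.
pose P := [set B : set H | [/\ B `<=` S, forall x, B x -> rnorm x = 1 &
      forall x y, B x -> B y -> x <> y -> hdot x y = 0]].
have [|B [[BS B1 Bo] Bmax]] := @Zorn_bigcup H P.
  move=> F FP Ftot; split => [x [X FX Xx]|x [X FX Xx]|x y [X FX Xx] [Y FY Yy] xy].
  - by have [h _ _] := FP _ FX; exact: h.
  - by have [_ h _] := FP _ FX; exact: h.
  - have [XY|YX] := Ftot _ _ FX FY.
      by have [_ _ h] := FP _ FY; apply: h => //; exact: XY.
    by have [_ _ h] := FP _ FX; apply: h => //; exact: YX.
exists B; split => // x Sx x1; apply: contrapT => /forall2NP nx.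
have {}nx y : B y -> hdot x y = 0 by move=> By; have [//|/contrapT] := nx y.
have Bx : ~ B x.
  move=> /nx /hdotxx_eq0 x0; move: x1; rewrite x0 rnorm0 => /esym/eqP.
  by rewrite oner_eq0.
apply: (Bmax (B `|` [set x])).
  split; last by move=> /(_ x (or_intror erefl)).
  by move=> y By; left.
split.
- by move=> y [/BS//|->].
- by move=> y [/B1//|->].
- move=> y z [By|->] [Bz|->]// yz; [exact: Bo| |exact: nx].
  by rewrite hdotC nx// rmorph0.
Qed.

(** Distinct members are at distance sqrt 2, so each of them is the only one
    within 1/2 of the point of a countable dense set that approximates it. *)
Lemma orthonormal_countable (B : set H) : separable_space H ->
  (forall x, B x -> rnorm x = 1) ->
  (forall x y, B x -> B y -> x <> y -> hdot x y = 0) -> countable B.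
Proof.
move=> [D /countable_injP[g ginj] Ddense] B1 Bo.
have h2 : (0 : C) < (2^-1 : R)%:C%C by rewrite ltcR invr_gt0.
have /choice[d dP] x : exists d, D d /\ rnorm (x - d) < 2^-1.
  have [|d [dx Dd]] := Ddense (ball x (2^-1 : R)%:C%C) _ (@ball_open _ _ x _).
    by exists x; exact: ballxx.
  by exists d; split => //; move: dx; rewrite -ball_normE /= -rnormE ltcR.
apply/countable_injP; exists (g \o d) => x y /set_mem Bx /set_mem By /= gd.
apply: contrapT => xy.
have dxy : d x = d y by apply: ginj => //; apply/mem_set; exact: (dP _).1.
have : rnorm (x - y) ^+ 2 = 2.
  by rewrite sqr_rnormB !B1// Bo//= mul0rn subr0 expr1n.
have : rnorm (x - y) < 1.
  have -> : x - y = (x - d x) - (y - d y) by rewrite dxy opprB addrA subrK.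
  apply: le_lt_trans (rnormD _ _) _; rewrite rnormN.
  by have := (dP x).2; have := (dP y).2; lra.
have := rnorm_ge0 (x - y); move: (rnorm _) => r r0 r1.
rewrite expr2; nra.
Qed.

(** The terms are chosen inside S, which is going to be the union of the ranges of
    the atoms. *)
Lemma exists_orthonormal_seq (S : set H) : separable_space H ->
  (forall (a : C) x, S x -> S (a *: x)) ->
  exists b, [/\ orthonormal_seq b, forall n, b n = 0 \/ S (b n) &
    forall x, S x -> (forall n, hdot x (b n) = 0) -> x = 0].
Proof.
move=> Hsep SZ; have [B [BS B1 Bo Bmax]] := exists_maximal_orthonormal S.
have /countable_injP[g ginj] := orthonormal_countable Hsep B1 Bo.
have /choice[b bP] n : exists x, (B x /\ g x = n) \/ (x = 0 /\ forall y, B y -> g y <> n).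
  have [[x [Bx gx]]|/forallNP h] := pselect (exists x, B x /\ g x = n).
    by exists x; left.
  by exists 0; right; split => // y By gy; apply: (h y).
exists b; split; [split| |].
- by move=> n; have [[/B1]|[]] := bP n; [right|left].
- move=> m n mn; have [[Bm gm]|[-> _]] := bP m; last by rewrite hdot0l.
  have [[Bn gn]|[-> _]] := bP n; last by rewrite hdot0r.
  by apply: Bo => // e; move/eqP: mn; apply; rewrite -gm -gn e.
- by move=> n; have [[/BS]|[]] := bP n; [right|left].
- move=> x Sx xb; apply: contrapT => x0.
  have [||y By] := Bmax (((rnorm x)^-1)%:C%C *: x).
  + exact: SZ.
  + exact: rnorm_normalize.
  apply; rewrite hdotZl.
  have [[By' gy]|[_ /(_ y By)]//] := bP (g y).
  rewrite (_ : y = b (g y)) ?xb ?mulr0//.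
  by apply: ginj; rewrite ?gy//; exact/mem_set.
Qed.

Definition fourier_sum b n x := \sum_(k < n) hdot x (b k) *: b k.

Definition coef b x k : R := rnorm (hdot x (b k) : C).

Section fourier.
Variable b : nat -> H.
Hypothesis b_on : orthonormal_seq b.

(** Covers the zero terms of the sequence together with the unit ones. *)
Lemma hdot_coef x k : hdot x (b k) * hdot (b k) (b k) = hdot x (b k).
Proof.
have [->|bk] := b_on.1 k; first by rewrite !hdot0r mul0r.
by rewrite hdot_rnorm bk expr1n mulr1.
Qed.

Lemma hdot_fourier_sum n x k :
  hdot (fourier_sum b n x) (b k) = if (k < n)%N then hdot x (b k) else 0.
Proof.
rewrite hdot_suml; case: ltnP => kn.
  rewrite (bigD1 (Ordinal kn))//= hdotZl hdot_coef big1 ?addr0// => i ik.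
  by rewrite hdotZl b_on.2 ?mulr0.
rewrite big1// => i _; rewrite hdotZl b_on.2 ?mulr0//.
by rewrite neq_ltn (leq_trans (ltn_ord i) kn).
Qed.

Lemma conjM_rnorm (a : C) : a^* * a = (rnorm a ^+ 2)%:C%C.
Proof. by rewrite mulrC -normCK rmorphXn/= rnormE. Qed.

Lemma hdotr_fourier_sum n x :
  hdot x (fourier_sum b n x) = (\sum_(k < n) coef b x k ^+ 2)%:C%C.
Proof.
rewrite hdot_sumr rmorph_sum/=; apply: eq_bigr => k _.
by rewrite hdotZr conjM_rnorm.
Qed.

Lemma rnorm_fourier_sum n x :
  rnorm (fourier_sum b n x) ^+ 2 = \sum_(k < n) coef b x k ^+ 2.
Proof.
rewrite rnorm_sqr {2}/fourier_sum hdot_sumr raddf_sum/=; apply: eq_bigr => k _.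
by rewrite hdotZr hdot_fourier_sum ltn_ord conjM_rnorm.
Qed.

Lemma rnorm_fourier_rest n x : rnorm (x - fourier_sum b n x) ^+ 2 =
  rnorm x ^+ 2 - \sum_(k < n) coef b x k ^+ 2.
Proof.
rewrite sqr_rnormB rnorm_fourier_sum hdotr_fourier_sum/= mulr2n.
by rewrite opprD addrA addrK.
Qed.

Lemma bessel n x : \sum_(k < n) coef b x k ^+ 2 <= rnorm x ^+ 2.
Proof. by rewrite -subr_ge0 -rnorm_fourier_rest sqr_ge0. Qed.

Lemma rnorm_fourier_diff m n x : (m <= n)%N ->
  rnorm (fourier_sum b n x - fourier_sum b m x) ^+ 2 =
  \sum_(k < n) coef b x k ^+ 2 - \sum_(k < m) coef b x k ^+ 2.
Proof.
move=> mn; have -> : fourier_sum b m x = fourier_sum b m (fourier_sum b n x).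
  apply: eq_bigr => k _.
  by rewrite hdot_fourier_sum (leq_trans (ltn_ord k) mn).
rewrite rnorm_fourier_rest rnorm_fourier_sum; congr (_ - _).
apply: eq_bigr => k _.
by rewrite /coef hdot_fourier_sum (leq_trans (ltn_ord k) mn).
Qed.

Hypothesis b_total : total_seq b.

(** The partial sums are Cauchy because their squared distances are differences
    of the partial sums of the bounded series of squared coefficients; the limit
    has the same coefficients as x, so it is x by totality. *)
Lemma cvg_fourier x : (fourier_sum b ^~ x) @ \oo --> x.
Proof.
pose s n := \sum_(k < n) coef b x k ^+ 2.
have snd : nondecreasing_seq s.
  by move=> m n mn; rewrite -subr_ge0 -rnorm_fourier_diff// sqr_ge0.
have sc : cvgn s.
  apply: nondecreasing_is_cvgn => //.
  by exists (rnorm x ^+ 2) => _ [n _ <-]; exact: bessel.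
have [z uz] : exists z : H, (fourier_sum b ^~ x) @ \oo --> z.
  apply: cauchy_rnorm => e e0.
  have /cvgrPdist_le/(_ (e ^+ 2) (exprn_gt0 _ e0))[N _ hN] := sc.
  have key m n : (N <= m)%N -> (m <= n)%N ->
      rnorm (fourier_sum b n x - fourier_sum b m x) <= e.
    move=> Nm mn; rewrite -ler_sqr ?nnegrE ?rnorm_ge0 ?(ltW e0)//.
    rewrite rnorm_fourier_diff//; have := hN _ Nm; rewrite /= ler_norml => /andP[_].
    apply: le_trans; apply: lerB => //.
    exact: nondecreasing_cvgn_le.
  exists N => m n Nm Nn; have [mn|/ltnW nm] := leqP m n.
    by rewrite rnormC; exact: key.
  exact: key.
suff xz : x = z by rewrite [X in _ --> X]xz.
apply/eqP; rewrite -subr_eq0; apply/eqP/b_total => k.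
rewrite hdotBl; apply/eqP; rewrite subr_eq0; apply/eqP.
have := cvg_hdotl (y:=b k) uz.
have : (fun n => hdot (fourier_sum b n x) (b k) : C^o) @ \oo --> (hdot x (b k) : C^o).
  apply: (@cvg_near_cst _ C^o); exists k.+1 => // n /= kn.
  by rewrite hdot_fourier_sum kn.
exact: (cvg_unique (@norm_hausdorff _ C^o)).
Qed.

Lemma parseval x : (fun n => \sum_(k < n) coef b x k ^+ 2) @ \oo --> rnorm x ^+ 2.
Proof.
have c := cvg_rnorm (cvg_fourier (x:=x)).
by under eq_fun do rewrite -rnorm_fourier_sum expr2; rewrite expr2; exact: cvgM.
Qed.

End fourier.
End orthonormal.

(** * Atoms of a commutative subspace lattice *)

Section lattices.
Variables (R : realType).
Local Notation C := R[i].
Implicit Types (H : hilbertType R).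

Lemma bop_compE H K M (S : 'B(K, M)) (T : 'B(H, K)) x : (S \ob T) x = S (T x).
Proof. by []. Qed.

Lemma bop_congr H K (S T : 'B(H, K)) x : S = T -> S x = T x.
Proof. by move=> ->. Qed.

Lemma bop_commE H (S T : 'B(H, H)) x : S \ob T = T \ob S -> S (T x) = T (S x).
Proof. exact: bop_congr. Qed.

Lemma proj_idem H (P : 'B(H, H)) x : is_projection P -> P (P x) = P x.
Proof. by move=> [/(congr1 (fun T : 'B(H, H) => T x))]. Qed.

Lemma proj_sa H (P : 'B(H, H)) x y : is_projection P -> hdot (P x) y = hdot x (P y).
Proof. by move=> [_]; apply. Qed.

Lemma proj_leP H (P Q : 'B(H, H)) : proj_le P Q <-> forall x, Q (P x) = P x.
Proof. by split=> [/(@bop_congr _ _ _ _)//|h]; apply: bop_eq. Qed.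

Lemma is_projectionC H (P : 'B(H, H)) : is_projection P -> is_projection (bop_id - P).
Proof.
move=> Pp; split; first apply: bop_eq => x.
  by rewrite bop_compE !bopBE/= bopB proj_idem// subrr subr0.
by move=> x y; rewrite !bopBE/= hdotBl hdotBr proj_sa.
Qed.

(** The infimum projects onto the intersection of the ranges; characterizing it
    by the vectors that it fixes is what the atoms need. *)
Lemma exists_proj_inf H (F : set 'B(H, H)) : exists P, is_proj_inf F P /\
  forall x, P x = x <-> forall Q, F Q -> Q x = x.
Proof.
have [P [Pp PP]] := exists_projection_onto_ker [set bop_id - Q | Q in F].
have {}PP x : P x = x <-> forall Q, F Q -> Q x = x.
  apply: iff_trans (PP x) _; split=> [h Q FQ|h _ [Q FQ <-]].
    have /h := imageP (fun Q => bop_id - Q) FQ.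
    by rewrite bopBE/= => /eqP; rewrite subr_eq0 => /eqP.
  by rewrite bopBE/= h// subrr.
exists P; split=> //; split=> // [Q FQ|P' P'p P'F]; apply/proj_leP => x.
  by apply: (PP (P x)).1 => //; exact: proj_idem.
by apply/PP => Q /P'F/proj_leP.
Qed.

(** The supremum is the complement of the projection onto the intersection of
    the kernels. *)
Lemma exists_proj_sup H (F : set 'B(H, H)) : (forall Q, F Q -> is_projection Q) ->
  exists P, is_proj_sup F P /\ forall x, P x = 0 <-> forall Q, F Q -> Q x = 0.
Proof.
move=> Fp; have [P [Pp PP]] := exists_projection_onto_ker F.
have Sp := is_projectionC Pp; exists (bop_id - P); split; last first.
  move=> x; apply: iff_trans (PP x).
  rewrite bopBE/=; split=> [/eqP|->]; last exact: subrr.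
  by rewrite subr_eq0 => /eqP/esym.
have PF x Q : F Q -> Q (P x) = 0 by apply: (PP (P x)).1; exact: proj_idem.
split=> // [Q FQ|P' P'p P'F]; apply/proj_leP => x; rewrite bopBE/=.
  rewrite (_ : P (Q x) = 0) ?subr0//; apply: hdot_eq => y.
  by rewrite hdot0l proj_sa// (proj_sa _ _ (Fp _ FQ)) PF// hdot0r.
have PP' y : P (y - P' y) = y - P' y.
  apply/PP => Q FQ; rewrite bopB; apply: hdot_eq => z.
  rewrite hdotBl hdot0l !(proj_sa _ _ (Fp _ FQ)) proj_sa//.
  by rewrite ((proj_leP _ _).1 (P'F _ FQ)) subrr.
apply: hdot_eq => y; rewrite proj_sa//; apply/esym/eqP; rewrite -subr_eq0 -hdotBr.
by rewrite -PP' -proj_sa// bopB proj_idem// subrr hdot0l.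
Qed.

Lemma lattice_inf H (L F : set 'B(H, H)) : subspace_lattice L -> F `<=` L ->
  exists2 P, L P & forall x, P x = x <-> forall Q, F Q -> Q x = x.
Proof.
move=> [_ _ _ _ Linf] FL; have [P [Pinf PP]] := exists_proj_inf F.
by exists P => //; exact: Linf FL Pinf.
Qed.

Lemma lattice_sup H (L F : set 'B(H, H)) : subspace_lattice L -> F `<=` L ->
  exists2 P, L P & forall x, P x = 0 <-> forall Q, F Q -> Q x = 0.
Proof.
move=> [Lp _ _ Lsup _] FL.
have [P [Psup PP]] := exists_proj_sup (fun Q FQ => Lp Q (FL Q FQ)).
by exists P => //; exact: Lsup FL Psup.
Qed.

Lemma bicommutant_commute H (L : set 'B(H, H)) (S T : 'B(H, H)) :
  (forall P Q, L P -> L Q -> P \ob Q = Q \ob P) ->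
  commutant (commutant L) S -> commutant (commutant L) T -> S \ob T = T \ob S.
Proof.
move=> Lc SL TL; apply: SL => P LP; apply: TL => Q LQ; exact: Lc.
Qed.

Lemma sub_bicommutant H (L : set 'B(H, H)) : L `<=` commutant (commutant L).
Proof. by move=> P LP Q QL; rewrite QL. Qed.

Section atoms.
Variables (H : hilbertType R) (L : set 'B(H, H)).
Hypothesis L_CSL : CSL L.
Let N := commutant (commutant L).
Let Nc S T : N S -> N T -> S \ob T = T \ob S.
Proof. exact: bicommutant_commute L_CSL.2. Qed.

(** P commutes with e, so P e is a projection below the minimal projection e. *)
Lemma atom_dichotomy (e P : 'B(H, H)) : minimal_projection N e ->
  N P -> is_projection P -> (forall x, P (e x) = 0) \/ (forall x, P (e x) = e x).
Proof.
move=> [Ne ep e0 emin] NP Pp.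
have c x : P (e x) = e (P x) by exact: bop_congr (Nc NP Ne).
have [| | | |] := emin (P \ob e).
- by move=> B NB; apply: bop_eq => x /=; rewrite (bop_commE _ (Ne _ NB)) (bop_commE _ (NP _ NB)).
- split; first by apply: bop_eq => x /=; rewrite -c proj_idem// proj_idem.
  by move=> x y /=; rewrite !(proj_sa, c).
- by apply/proj_leP => x /=; rewrite -c proj_idem.
- by move=> h; left => x; rewrite -[LHS]/((P \ob e) x) h.
- by move=> h; right => x; rewrite -[LHS]/((P \ob e) x) h.
Qed.

Lemma atoms_orthogonal (e f : 'B(H, H)) : minimal_projection N e ->
  minimal_projection N f -> e = f \/ forall x, e (f x) = 0.
Proof.
move=> me mf; have [Ne ep _ _] := me; have [Nf fp _ _] := mf.
have [|ef] := atom_dichotomy mf Ne ep; first by right.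
have [fe|fe] := atom_dichotomy me Nf fp; [right|left].
  by move=> x; rewrite (bop_commE _ (Nc Ne Nf)) fe.
by apply: bop_eq => x; rewrite -fe -[RHS]ef; exact: bop_commE (Nc Nf Ne).
Qed.

(** A vector orthogonal to the basis is killed by each atom e, because e maps it
    into the range of e, where it is orthogonal to all basis vectors. Hence its
    span is below the complement of every atom, which is impossible for a nonzero
    vector when the atoms have supremum the identity. *)
Lemma atomic_basis : totally_atomic L -> separable_space H ->
  exists b : nat -> H, [/\ orthonormal_seq b, total_seq b &
    forall n, b n = 0 \/ exists2 e, minimal_projection N e & e (b n) = b n].
Proof.
move=> [_ _ Lat] Hsep.
have [|b [bon bS btot]] :=
  @exists_orthonormal_seq R H [set x | exists2 e, minimal_projection N e & e x = x] Hsep.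
  by move=> a x [e me ex]; exists e => //; rewrite bopZ ex.
exists b; split=> // x xb.
have ex0 e : minimal_projection N e -> e x = 0.
  move=> me; have [Ne ep _ _] := me; apply: btot.
    by exists e => //; exact: proj_idem.
  move=> n; have [->|[f mf fb]] := bS n; first exact: hdot0r.
  rewrite proj_sa// -fb; have [ef|->] := atoms_orthogonal me mf.
    by rewrite -ef proj_idem// ef fb.
  exact: hdot0r.
have [P [Pp PP]] := exists_projection_onto_ker (minimal_projection N).
have /proj_leP/(_ x) : proj_le bop_id (bop_id - P).
  apply: Lat; first exact: is_projectionC.
  move=> e me; have [_ ep _ _] := me; apply/proj_leP => y.
  rewrite bopBE/= (_ : P (e y) = 0) ?subr0//; apply: hdot_eq => z.
  rewrite proj_sa// proj_sa// hdot0l (PP (P z)).1 ?hdot0r//.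
  exact: proj_idem.
by rewrite bopBE/= ((PP x).2 ex0) subrr => <-.
Qed.

End atoms.

(** Let A be the least member of L1 that fixes x and B the largest one that kills
    x. As A is not below B, phi A is not below phi B; since these commute, the
    part of the range of phi A that phi B kills is nonzero, and u is taken there.
    Every P in L1 lies above A or below B, and so phi P fixes or kills u. *)
Lemma atomic_vector_transfer (H1 H2 : hilbertType R) (L1 : set 'B(H1, H1))
    (L2 : set 'B(H2, H2)) (phi : 'B(H1, H1) -> 'B(H2, H2)) (x : H1) :
  CSL L1 -> CSL L2 -> (forall P, L1 P -> L2 (phi P)) ->
  (forall P Q, L1 P -> L1 Q -> (proj_le P Q <-> proj_le (phi P) (phi Q))) ->
  x <> 0 -> (forall P, L1 P -> P x = x \/ P x = 0) ->
  exists2 u, rnorm u = 1 & forall P, L1 P ->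
    (P x = x /\ phi P u = u) \/ (P x = 0 /\ phi P u = 0).
Proof.
move=> L1c L2c phiL phiM x0 xL.
have L1p P : L1 P -> is_projection P by case: L1c => -[h _ _ _ _] _; exact: h.
have L2p P : L2 P -> is_projection P by case: L2c => -[h _ _ _ _] _; exact: h.
have [A LA AP] : exists2 P, L1 P & forall y, P y = y <->
    forall Q, [set Q | L1 Q /\ Q x = x] Q -> Q y = y.
  by apply: lattice_inf; [exact: L1c.1|move=> Q []].
have [B LB BP] : exists2 P, L1 P & forall y, P y = 0 <->
    forall Q, [set Q | L1 Q /\ Q x = 0] Q -> Q y = 0.
  by apply: lattice_sup; [exact: L1c.1|move=> Q []].
have Ax : A x = x by apply/AP => Q [].
have Bx : B x = 0 by apply/BP => Q [].
have nAB : ~ proj_le (phi A) (phi B).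
  by move=> /(phiM _ _ LA LB)/proj_leP/(_ x); rewrite Ax Bx => /esym.
have [y yAB] : exists y, phi B (phi A y) <> phi A y.
  by apply: contrapT => /forallNP h; apply/nAB/proj_leP => y; exact: contrapT.
have LA' := phiL _ LA; have LB' := phiL _ LB.
have com P Q z : L2 P -> L2 Q -> P (Q z) = Q (P z).
  by move=> LP LQ; exact: bop_congr (L2c.2 _ _ LP LQ).
pose v := phi A y - phi B (phi A y).
have v0 : v <> 0 by move=> /eqP; rewrite subr_eq0 => /eqP/esym.
have Av : phi A v = v.
  by rewrite bopB (com _ _ _ LA' LB') !(proj_idem _ (L2p _ LA')).
have Bv : phi B v = 0 by rewrite bopB (proj_idem _ (L2p _ LB')) subrr.
exists ((rnorm v)^-1%:C%C *: v).
  exact: rnorm_normalize.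
move=> P LP; have [Px|Px] := xL _ LP; [left|right]; split=> //; rewrite bopZ.
  have /(phiM _ _ LA LP)/proj_leP AleP : proj_le A P.
    apply/proj_leP => z; apply: (AP (A z)).1; last by split.
    exact: proj_idem (L1p _ LA).
  by rewrite -Av AleP.
have /(phiM _ _ LP LB)/proj_leP PleB : proj_le P B.
  apply/proj_leP => z.
  have -> : B (P z) = P (B z) by exact: bop_congr (L1c.2 _ _ LB LP).
  apply/esym/eqP; rewrite -subr_eq0 -bopB; apply/eqP.
  apply: (BP (z - B z)).1; last by split.
  by rewrite bopB (proj_idem _ (L1p _ LB)) subrr.
by rewrite -PleB (com _ _ _ LB' (phiL _ LP)) Bv bop0 scaler0.
Qed.

Lemma intertwining_sequences (H1 H2 : hilbertType R) (L1 : set 'B(H1, H1))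
    (L2 : set 'B(H2, H2)) (phi : 'B(H1, H1) -> 'B(H2, H2)) :
  CSL L1 -> CSL L2 -> totally_atomic L1 -> separable_space H1 ->
  (forall P, L1 P -> L2 (phi P)) ->
  (forall P Q, L1 P -> L1 Q -> (proj_le P Q <-> proj_le (phi P) (phi Q))) ->
  exists (b : nat -> H1) (u : nat -> H2),
    [/\ orthonormal_seq b, total_seq b,
        forall n, b n = 0 \/ rnorm (u n) = 1 &
        forall n P, L1 P ->
          (P (b n) = b n /\ phi P (u n) = u n) \/ (P (b n) = 0 /\ phi P (u n) = 0)].
Proof.
move=> L1c L2c L1at Hsep phiL phiM.
have [b [bon btot bat]] := atomic_basis L1c L1at Hsep.
have /choice[u uP] n : exists u, (b n = 0 \/ rnorm u = 1) /\ forall P, L1 P ->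
    (P (b n) = b n /\ phi P u = u) \/ (P (b n) = 0 /\ phi P u = 0).
  have [b0|bn0] := pselect (b n = 0).
    by exists 0; split=> [|P LP]; left=> //; rewrite b0 !bop0.
  have [//|[e me ebn]] := bat n.
  have [|u u1 uP] := atomic_vector_transfer L1c L2c phiL phiM bn0.
    move=> P LP; have Pp : is_projection P by case: L1c => -[h _ _ _ _] _; exact: h.
    rewrite -ebn; have NP := sub_bicommutant LP.
    by have [h|h] := atom_dichotomy L1c me NP Pp; [right|left]; exact: h.
  by exists u; split=> //; right.
exists b, u; split=> // n; first exact: (uP n).1.
exact: (uP n).2.
Qed.

End lattices.

(** * Ampliations and weak* limits *)

Section ell2_operators.
Variables (R : realType).
Local Notation C := R[i].
Implicit Types (H K X : hilbertType R).

(** An operator into the direct sum given by its components; the bound on the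
    partial sums provides square summability and boundedness at once. *)
Lemma exists_bop_ell2 X K (f : X -> nat -> K) (M : R) : 0 <= M ->
  (forall i, linear (f ^~ i)) ->
  (forall x n, \sum_(i < n) rnorm (f x i) ^+ 2 <= (M * rnorm x) ^+ 2) ->
  exists T : 'B(X, ell2 K), forall x i, T x i = f x i.
Proof.
move=> M0 fl fM.
have fM' x n : series (fun i => rnorm (f x i) ^+ 2) n <= (M * rnorm x) ^+ 2.
  by rewrite /series/= big_mkord.
have fP x : f x \in @sqsummable R K.
  apply/sqsummableP/nondecreasing_is_cvgn.
    by apply: nondecreasing_series => i _ _; exact: sqr_ge0.
  by exists ((M * rnorm x) ^+ 2) => _ [n _ <-].
pose g x : ell2 K := Ell2 (fP x).
have [||T TP] := @exists_bop R X (ell2 K) g M.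
- by move=> a x y; apply: ell2P_eq => i; rewrite ell2DE ell2ZE; exact: fl.
- by move=> x; apply: ell2_rnorm_le; [rewrite mulr_ge0 ?rnorm_ge0|move=> n; exact: fM'].
by exists T => x i; rewrite TP.
Qed.

Lemma ell2_sum_le H (x : ell2 H) n : \sum_(i < n) rnorm (x i) ^+ 2 <= rnorm x ^+ 2.
Proof. by have := ell2_series_le x n; rewrite /series/= big_mkord. Qed.

Lemma exists_ampl H K (T : 'B(H, K)) :
  exists S : 'B(ell2 H, ell2 K), forall x i, S x i = T (x i).
Proof.
have [M M0 MT] := bop_bounded T.
apply: (@exists_bop_ell2 (ell2 H) K (fun x i => T (x i)) M) => // [i a x y|x n].
  by rewrite ell2DE ell2ZE bop_linear.
rewrite exprMn; apply: le_trans (ler_wpM2l (sqr_ge0 M) (ell2_sum_le x n)).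
rewrite mulr_sumr; apply: ler_sum => i _.
by rewrite -exprMn lerXn2r ?nnegrE ?mulr_ge0 ?rnorm_ge0.
Qed.

Definition ampl H K (T : 'B(H, K)) : 'B(ell2 H, ell2 K) := projT1 (cid (exists_ampl T)).
Lemma amplE H K (T : 'B(H, K)) x i : ampl T x i = T (x i).
Proof. exact: (projT2 (cid (exists_ampl T))). Qed.

Lemma exists_ell2_inj H k : exists S : 'B(H, ell2 H),
  forall x i, S x i = if i == k then x else 0.
Proof.
apply: (@exists_bop_ell2 H H (fun (x : H) i => if i == k then x else 0) 1) => // [i a x y|x n].
  by case: eqP => //; rewrite scaler0 addr0.
rewrite mul1r; case: (ltnP k n) => kn.
  rewrite (bigD1 (Ordinal kn))//= eqxx big1 ?addr0// => i /eqP ik.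
  by case: eqP => [e|_]; [exfalso; apply: ik; exact: val_inj|rewrite rnorm0 expr0n].
rewrite big1 ?sqr_ge0// => i _; case: eqP => [e|_]; last by rewrite rnorm0 expr0n.
by have := ltn_ord i; rewrite e ltnNge kn.
Qed.

Definition ell2_inj H k : 'B(H, ell2 H) := projT1 (cid (exists_ell2_inj H k)).
Lemma ell2_injE H k (x : H) i : ell2_inj H k x i = if i == k then x else 0.
Proof. exact: (projT2 (cid (exists_ell2_inj H k))). Qed.

Lemma exists_rank1 H K (u : K) (v : H) : exists T : 'B(H, K), forall x, T x = hdot x v *: u.
Proof.
apply: (@exists_bop _ _ _ (fun x => hdot x v *: u) (rnorm v * rnorm u)).
  by move=> a x y; rewrite hdotDl hdotZl scalerDl scalerA.
move=> x; rewrite rnormZ mulrAC ler_wpM2r ?rnorm_ge0// mulrC.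
exact: hdot_CauchySchwarz.
Qed.

Definition rank1 H K (u : K) (v : H) : 'B(H, K) := projT1 (cid (exists_rank1 u v)).
Lemma rank1E H K (u : K) (v x : H) : rank1 u v x = hdot x v *: u.
Proof. exact: (projT2 (cid (exists_rank1 u v))). Qed.

Lemma rank1_adjoint H K (u : K) (v : H) : is_adjoint (rank1 u v) (rank1 v u).
Proof.
move=> x y; rewrite !rank1E hdotZl hdotZr mulrC; congr (_ * _).
by rewrite hdotC.
Qed.

(** Weak* continuous functionals are vector functionals of the ampliation, so
    weak* convergence follows from strong convergence on the direct sum. *)
Lemma wstar_evalE H K (T : 'B(H, K)) p : wstar_eval T p = hdot (ampl T p.1) p.2.
Proof.
rewrite -[RHS]/(limn (series (fun i => hdot (ampl T p.1 i) (p.2 i) : C^o))).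
by congr (limn (series _)); apply/funext => i; rewrite amplE.
Qed.

(** In particular the vector functionals are weak* continuous. *)
Lemma wstar_eval_inj H K (T : 'B(H, K)) x y :
  wstar_eval T (ell2_inj H 0 x, ell2_inj K 0 y) = hdot (T x) y.
Proof.
apply: (@cvg_lim C^o) => //; apply: (@cvg_near_cst _ C^o).
exists 1%N => // n /= n0; rewrite /series/= big_mkord.
rewrite (bigD1 (Ordinal n0))//= !ell2_injE eqxx big1 ?addr0// => i i0.
rewrite !ell2_injE; case: eqP => [e|_]; last by rewrite hdot0r.
by move/eqP: i0; case; apply: val_inj.
Qed.

Lemma wstar_eval_continuous H K p :
  continuous (fun T : initial_topology (@wstar_eval R H K) => wstar_eval T p).
Proof.
have c := @proj_continuous (ell2 H * ell2 K)%type (fun=> C^o) p.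
move=> T; have i := @initial_continuous _ _ (@wstar_eval R H K) T.
exact: (continuous_comp i (c _)).
Qed.

Lemma wstar_closure_seq H K (X : set 'B(H, K)) (A : nat -> 'B(H, K)) (T : 'B(H, K)) :
  (forall n, X (A n)) ->
  (forall p, (fun n => wstar_eval (A n) p) @ \oo --> wstar_eval T p) ->
  wstar_closure X T.
Proof.
move=> XA AT.
have c : (fun n => wstar_eval (A n)) @ \oo --> wstar_eval T.
  apply/cvg_sup => p B.
  case=> _ [[D Dop <-] Dp] DB; apply: filterS DB _.
  by apply: AT; apply: open_nbhs_nbhs.
move=> B [_ [[D Dop <-] Dp] DB].
have [N _ hN] := c D (open_nbhs_nbhs (conj Dop Dp)).
exists (A N); split => //; apply: DB; exact: (hN N (leqnn N)).
Qed.

Lemma wstar_closure_vanish H K (X : set 'B(H, K)) (T : 'B(H, K)) x y :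
  (forall S, X S -> hdot (S x) y = 0) -> wstar_closure X T -> hdot (T x) y = 0.
Proof.
move=> X0 XT; rewrite -wstar_eval_inj; set p := (_, _).
have cl : closed [set S : initial_topology (@wstar_eval R H K) | wstar_eval S p = 0].
  apply: (@closed_comp _ _ (fun S : initial_topology (@wstar_eval R H K) => wstar_eval S p) [set 0]).
    by move=> S _; exact: wstar_eval_continuous.
  exact/accessible_closed_set1/hausdorff_accessible/(@norm_hausdorff _ C^o).
apply: cl; apply: closureS XT => S XS /=.
by rewrite wstar_eval_inj X0.
Qed.

End ell2_operators.

(** * Intertwiners and weak TRO equivalence *)

Section tro.
Variables (R : realType).
Local Notation C := R[i].
Implicit Types (H K : hilbertType R).

Lemma cvg_hdot H (u v : nat -> H) (x y : H) : u @ \oo --> x -> v @ \oo --> y ->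
  (fun n => hdot (u n) (v n) : C^o) @ \oo --> (hdot x y : C^o).
Proof.
move=> ux vy.
have E : (fun n => hdot (u n) (v n) : C^o) =
    (fun n => hdot (u n - x) (v n) + (hdot x (v n) : C^o)).
  by apply/funext => n; rewrite -hdotDl subrK.
rewrite E -[X in _ --> X]add0r; apply: cvgD; last first.
  have -> : (fun n => hdot x (v n) : C^o) =
      (@conjC C : C^o -> C^o) \o (fun n => hdot (v n) x : C^o).
    by apply/funext => n; exact: hdotC.
  rewrite [hdot x y]hdotC.
  apply: continuous_cvg; first exact: conjC_continuous.
  exact: cvg_hdotl.
apply/cvgrPdist_le => e e0; have e0' : 0 < complex.Re e by rewrite -ltcR ge0_cReK// ltW.
have /cvg_rnormP/(_ 1 ltr01)[N1 hN1] := vy.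
have y0 : 0 < rnorm y + 1 by rewrite ltr_wpDl ?rnorm_ge0.
have /cvg_rnormP/(_ (complex.Re e / (rnorm y + 1)) (divr_gt0 e0' y0))[N2 hN2] := ux.
exists (maxn N1 N2) => // n /=; rewrite geq_max => /andP[/hN1 h1 /hN2 h2].
rewrite sub0r normrN -rnormE -[leRHS](ge0_cReK (ltW e0)) lecR.
apply: le_trans (hdot_CauchySchwarz _ _) _.
rewrite -[leRHS](divfK (lt0r_neq0 y0)); apply: ler_pM; rewrite ?rnorm_ge0//.
by have := rnormD (v n - y) y; rewrite subrK; lra.
Qed.

Lemma ampl_adjoint H K (T : 'B(H, K)) S : is_adjoint T S -> is_adjoint (ampl T) (ampl S).
Proof.
move=> TS x y.
rewrite -[LHS]/(limn (series (fun i => hdot (ampl T x i) (y i) : C^o))).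
rewrite -[RHS]/(limn (series (fun i => hdot (x i) (ampl S y i) : C^o))).
by congr (limn (series _)); apply/funext => i; rewrite !amplE TS.
Qed.

Lemma ampl_comp H K M (T : 'B(H, K)) (S : 'B(K, M)) : ampl (S \ob T) = ampl S \ob ampl T.
Proof. by apply: bop_eq => x; apply: ell2P_eq => i; rewrite /= !amplE. Qed.

(** The components converge one by one and the remainder of the squared norm
    beyond the first N components is at most the tail of the squared norm of x,
    uniformly in n. *)
Lemma cvg_ampl H (Q : nat -> 'B(H, H)) (x : ell2 H) :
  (forall n y, rnorm (Q n y - y) <= rnorm y) ->
  (forall y, (fun n => Q n y) @ \oo --> y) ->
  (fun n => ampl (Q n) x) @ \oo --> x.
Proof.
move=> Qle Qy; apply/cvg_rnormP => e e0.
have e2 : 0 < e ^+ 2 / 2 by rewrite divr_gt0// exprn_gt0.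
have : cvgn (series (fun i => rnorm (x i) ^+ 2)) by exact: ell2P.
move=> /cvgrPdist_le/(_ _ e2)[N _ /(_ N (leqnn N))].
rewrite -ell2_rnorm_sqr ler_norml => /andP[_ hN].
have c : (fun n => \sum_(0 <= i < N) rnorm (Q n (x i) - x i) ^+ 2) @ \oo --> (0 : R).
  rewrite -[X in _ --> X](@big1_eq R 0 +%R nat (index_iota 0 N) xpredT).
  apply: cvg_big => [|i _]; first exact: add_continuous.
  have h : (fun n => rnorm (Q n (x i) - x i)) @ \oo --> (0 : R).
    rewrite -(@rnorm0 R H) -(subrr (x i)); apply: cvg_rnorm.
    by apply: cvgB; [exact: Qy|exact: cvg_cst].
  by rewrite -[X in _ --> X](mulr0 0); exact: (cvgM h h).
have /cvgrPdist_le/(_ _ e2)[n0 _ hn0] := c.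
exists n0 => n nn0; apply: ell2_rnorm_le; first exact: ltW.
move=> m; have := hn0 n nn0; rewrite /= sub0r normrN ger0_norm ?sumr_ge0// => [h|i _]; last exact: sqr_ge0.
rewrite /series/=.
have E i : rnorm ((ampl (Q n) x - x) i) = rnorm (Q n (x i) - x i) by rewrite ell2BE amplE.
under eq_bigr do rewrite E.
apply: (@le_trans _ _ (\sum_(0 <= i < N + m) rnorm (Q n (x i) - x i) ^+ 2)).
  rewrite addnC [leRHS](big_cat_nat (n:=m)) ?leq_addr//= lerDl sumr_ge0// => i _.
  exact: sqr_ge0.
rewrite (big_cat_nat (n:=N)) ?leq_addr//=.
have : \sum_(N <= i < N + m) rnorm (Q n (x i) - x i) ^+ 2 <= \sum_(N <= i < N + m) rnorm (x i) ^+ 2.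
  by apply: ler_sum => i _; rewrite lerXn2r ?nnegrE ?rnorm_ge0.
have := ell2_series_le x (N + m); rewrite /series/= (big_cat_nat (n:=N)) ?leq_addr//=.
by move: hN; rewrite /series/=; lra.
Qed.

Lemma AlgP H (L : set 'B(H, H)) (A : 'B(H, H)) :
  Alg L A <-> forall P, L P -> forall x, P (A (P x)) = A (P x).
Proof.
split=> h P LP; last first.
  by apply: bop_eq => x; rewrite !bop_compE bopBE/= h// subrr.
move=> x; have := bop_congr x (h P LP); rewrite !bop_compE bopBE/= => /eqP.
by rewrite subr_eq0 => /eqP/esym.
Qed.

Lemma Alg_subspace H (L : set 'B(H, H)) : is_subspace (Alg L).
Proof.
split; first by apply/AlgP => P LP x; rewrite bop0E bop0.
move=> a S T /AlgP SL /AlgP TL; apply/AlgP => P LP x.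
by rewrite bopDE bopZE bop_linear SL// TL.
Qed.

Lemma Alg_wstar_closed H (L X : set 'B(H, H)) : (forall P, L P -> is_projection P) ->
  X `<=` Alg L -> wstar_closure X `<=` Alg L.
Proof.
move=> Lp XL T XT P LP; apply: bop_eq => x; apply: hdot_eq => y.
have Pp := Lp _ LP.
rewrite !bop_compE (proj_sa _ _ (is_projectionC Pp)) hdot0l.
apply: wstar_closure_vanish XT => S /XL SL.
rewrite -(proj_sa _ _ (is_projectionC Pp)).
by rewrite -[X in hdot X _]/(((bop_id - P) \ob S \ob P) x) SL// hdot0l.
Qed.

Section one_direction.
Variables (H K : hilbertType R) (L1 : set 'B(H, H)) (L2 : set 'B(K, K)).
Variable (phi : 'B(H, H) -> 'B(K, K)).
Hypothesis L1p : forall P, L1 P -> is_projection P.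
Hypothesis L2p : forall P, L2 P -> is_projection P.
Hypothesis phiL : forall P, L1 P -> L2 (phi P).
Variables (N : set 'B(K, H)) (N' : set 'B(H, K)).

Lemma wstar_span_compression :
  (forall T P, N T -> L1 P -> T \ob phi P = P \ob T) ->
  (forall S P, N' S -> L1 P -> S \ob P = phi P \ob S) ->
  wstar_span (set_comp (set_comp N (Alg L2)) N') `<=` Alg L1.
Proof.
move=> Nc N'c; apply: Alg_wstar_closed => //; apply: smallest_sub.
  exact: Alg_subspace.
move=> _ [_ [S [[T [A [NT AL ->]]] N'S ->]]]; apply/AlgP => P LP x /=.
have E z : S (P z) = phi P (S z) by exact: (bop_congr z (N'c _ _ N'S LP)).
have E' z : P (T z) = T (phi P z) by exact: (bop_congr z (esym (Nc _ _ NT LP))).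
have /AlgP AL' := AL.
by rewrite E E' AL'//; exact: phiL.
Qed.

Variables (b : nat -> H) (u : nat -> K).
Hypothesis phi_onto : forall Q, L2 Q -> exists2 P, L1 P & phi P = Q.
Hypothesis b_on : orthonormal_seq b.
Hypothesis b_total : total_seq b.
Hypothesis u_unit : forall n, b n = 0 \/ rnorm (u n) = 1.
Hypothesis bu : forall n P, L1 P ->
  (P (b n) = b n /\ phi P (u n) = u n) \/ (P (b n) = 0 /\ phi P (u n) = 0).

Lemma rank1_bu_intertwines n P : L1 P -> rank1 (b n) (u n) \ob phi P = P \ob rank1 (b n) (u n).
Proof.
move=> LP; apply: bop_eq => x /=; rewrite !rank1E bopZ (proj_sa _ _ (L2p (phiL LP))).
by have [[-> ->]//|[-> ->]] := bu n LP; rewrite hdot0r scale0r scaler0.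
Qed.

Lemma rank1_ub_intertwines n P : L1 P -> rank1 (u n) (b n) \ob P = phi P \ob rank1 (u n) (b n).
Proof.
move=> LP; apply: bop_eq => x /=; rewrite !rank1E bopZ (proj_sa _ _ (L1p LP)).
by have [[-> ->]//|[-> ->]] := bu n LP; rewrite hdot0r scale0r scaler0.
Qed.

(** A is the weak* limit of Q_n A Q_n, where Q_n is the partial sum operator of
    the Fourier expansion along b. If <A b_j, b_i> is nonzero then each P in L1
    that fixes b_j also fixes b_i, since A leaves the range of P invariant; by the
    hypothesis on u the same holds for phi P and u, and thus rank1 u_i u_j is in
    Alg L2. *)
Lemma Alg_sub_wstar_span :
  (forall n, N (rank1 (b n) (u n))) -> (forall n, N' (rank1 (u n) (b n))) ->
  Alg L1 `<=` wstar_span (set_comp (set_comp N (Alg L2)) N').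
Proof.
move=> Nbu N'ub A /AlgP AL; rewrite /wstar_span.
set Y := smallest _ _.
have Ysub : is_subspace Y.
  split=> [Z [Zs _]|a x y Yx Yy Z ZZ]; first exact: Zs.1.
  by apply: ZZ.1.2; [exact: Yx|exact: Yy].
have YX : set_comp (set_comp N (Alg L2)) N' `<=` Y by exact: sub_smallest.
have YD S T : Y S -> Y T -> Y (S + T) by move=> YS YT; rewrite -[S]scale1r; apply: Ysub.2.
pose Q n := \sum_(k < n) rank1 (b k) (b k).
have QE n x : Q n x = fourier_sum b n x.
  by rewrite /Q bop_sumE; apply: eq_bigr => k _; rewrite rank1E.
have Qa n : is_adjoint (Q n) (Q n).
  move=> x y; rewrite /Q !bop_sumE hdot_suml hdot_sumr; apply: eq_bigr => k _.
  exact: rank1_adjoint.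
pose D n := \sum_(i < n) \sum_(j < n) hdot (A (b j)) (b i) *: rank1 (b i) (b j).
have DE n : D n = Q n \ob A \ob Q n.
  apply: bop_eq => x; rewrite /= !QE /D bop_sumE; apply: eq_bigr => i _.
  rewrite bop_sumE /fourier_sum bop_sum hdot_suml scaler_suml; apply: eq_bigr => j _.
  by rewrite bopZE rank1E bopZ hdotZl scalerA mulrC.
apply: (@wstar_closure_seq _ _ _ _ D).
  move=> n; apply: big_ind => //; first exact: Ysub.1.
  move=> i _; apply: big_ind => //; first exact: Ysub.1.
  move=> j _; have [->|c0] := eqVneq (hdot (A (b j)) (b i)) 0.
    by rewrite scale0r; exact: Ysub.1.
  rewrite -[_ *: _]addr0; apply: Ysub.2; last exact: Ysub.1.
  have ui : rnorm (u i) = 1.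
    by have [bi0|//] := u_unit i; move: c0; rewrite bi0 hdot0r eqxx.
  have uj : rnorm (u j) = 1.
    by have [bj0|//] := u_unit j; move: c0; rewrite bj0 bop0 hdot0l eqxx.
  apply: YX; exists (rank1 (b i) (u i) \ob rank1 (u i) (u j)), (rank1 (u j) (b j)).
  split => //.
    exists (rank1 (b i) (u i)), (rank1 (u i) (u j)); split=> //.
    apply/AlgP => _ /phi_onto[P LP <-] x; rewrite rank1E bopZ.
    rewrite (proj_sa _ _ (L2p (phiL LP))).
    have [[Pbj Puj]|[_ ->]] := bu j LP; last by rewrite hdot0r !scale0r.
    have [[_ ->]//|[Pbi _]] := bu i LP.
    by move: c0; rewrite -Pbj -AL// (proj_sa _ _ (L1p LP)) Pbi hdot0r eqxx.
  apply: bop_eq => x; rewrite /= !rank1E !hdotZl.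
  by rewrite !hdot_rnorm ui uj expr1n !mulr1.
move=> [x y]; rewrite wstar_evalE/=.
have E n : wstar_eval (D n) (x, y) = hdot (ampl A (ampl (Q n) x)) (ampl (Q n) y).
  by rewrite wstar_evalE/= DE !ampl_comp/= (ampl_adjoint (Qa n)).
under eq_fun do rewrite E.
have cQ z : (fun n => ampl (Q n) z) @ \oo --> z.
  apply: cvg_ampl => [n w|w].
    rewrite QE rnormC -ler_sqr ?nnegrE ?rnorm_ge0// rnorm_fourier_rest//.
    by rewrite gerBl sumr_ge0// => k _; exact: sqr_ge0.
  by under eq_fun do rewrite QE; exact: cvg_fourier.
apply: cvg_hdot => //; exact: cvg_bop.
Qed.

End one_direction.

(** If T and S intertwine phi P and P, the adjoint of S intertwines P and phi P,
    as the projections are self-adjoint. *)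
Lemma TRO_intertwiners (H K : hilbertType R) (L1 : set 'B(H, H)) (phi : 'B(H, H) -> 'B(K, K)) :
  (forall P, L1 P -> is_projection P) -> (forall P, L1 P -> is_projection (phi P)) ->
  TRO [set T : 'B(K, H) | forall P, L1 P -> T \ob phi P = P \ob T].
Proof.
move=> L1p L2p; split; first split.
- by move=> P LP; apply: bop_eq => x; rewrite !bop_compE !bop0E bop0.
- move=> a S T SP TP P LP; apply: bop_eq => x; rewrite !bop_compE.
  rewrite !bopDE !bopZE bop_linear.
  by rewrite -[S _]/((S \ob phi P) x) -[T (phi P x)]/((T \ob phi P) x) SP// TP.
- move=> _ [_ [T [[S [T' [SM [S' S'M S'T'] ->]]] TM ->]]] P LP.
  apply: bop_eq => x /=.
  have c (Z : 'B(K, H)) z : (forall P, L1 P -> Z \ob phi P = P \ob Z) -> Z (phi P z) = P (Z z).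
    by move=> /(_ P LP); exact: bop_congr.
  rewrite c// -[in RHS]c//; congr (S _); apply: hdot_eq => y.
  rewrite (is_adjointC S'T') (proj_sa _ _ (L1p _ LP)).
  rewrite (proj_sa _ _ (L2p _ LP)) (is_adjointC S'T').
  by rewrite c.
Qed.

End tro.

(** * Matrices over a CSL algebra *)

Section ell2_coordinates.
Variables (R : realType).
Local Notation C := R[i].
Implicit Types (H K : hilbertType R).

Lemma exists_coord H k : exists T : 'B(ell2 H, H), forall x, T x = x k.
Proof.
apply: (@exists_bop R (ell2 H) H (fun x : ell2 H => x k) 1).
  by move=> a x y; rewrite ell2DE ell2ZE.
by move=> x; rewrite mul1r; exact: ell2_coord_le.
Qed.

Definition coord H k : 'B(ell2 H, H) := projT1 (cid (exists_coord H k)).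
Lemma coordE H k (x : ell2 H) : coord H k x = x k.
Proof. exact: (projT2 (cid (exists_coord H k))). Qed.

Lemma coord_adjoint H k : is_adjoint (coord H k) (ell2_inj H k).
Proof.
move=> x y; rewrite coordE; apply/esym.
rewrite -[LHS]/(limn (series (fun i => hdot (x i) (ell2_inj H k y i) : C^o))).
apply: (@cvg_lim C^o) => //; apply: (@cvg_near_cst _ C^o).
exists k.+1 => // n /= kn; rewrite /series/= big_mkord.
rewrite (bigD1 (Ordinal kn))//= ell2_injE eqxx big1 ?addr0// => i ik.
rewrite ell2_injE; case: eqP => [e|_]; last by rewrite hdot0r.
by move/eqP: ik; case; apply: val_inj.
Qed.

Definition finite_vector H (J : seq nat) (x : nat -> H) : ell2 H :=
  \sum_(j <- J) ell2_inj H j (x j).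

Lemma finite_vectorE H (J : seq nat) (x : nat -> H) i : uniq J ->
  finite_vector J x i = if i \in J then x i else 0.
Proof.
move=> uJ; rewrite -coordE bop_sum; case: ifPn => [iJ|iJ].
  rewrite (bigD1_seq i)//= coordE ell2_injE eqxx big1 ?addr0// => j ji.
  by rewrite coordE ell2_injE eq_sym (negbTE ji).
rewrite big_seq big1// => j jJ; rewrite coordE ell2_injE; case: eqP => // ij.
by rewrite ij jJ in iJ.
Qed.

Lemma hdot_finite_vector H (y : ell2 H) (J : seq nat) (x : nat -> H) :
  hdot y (finite_vector J x) = \sum_(j <- J) hdot (y j) (x j).
Proof.
by rewrite hdot_sumr; apply: eq_bigr => j _; rewrite -coord_adjoint coordE.
Qed.

Lemma rnorm_finite_vector H (J : seq nat) (x : nat -> H) : uniq J ->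
  rnorm (finite_vector J x) ^+ 2 = \sum_(j <- J) rnorm (x j) ^+ 2.
Proof.
move=> uJ; rewrite rnorm_sqr hdot_finite_vector raddf_sum/= big_seq [RHS]big_seq.
by apply: eq_bigr => j jJ; rewrite finite_vectorE// jJ rnorm_sqr.
Qed.

(** Finite truncations are orthogonal projections: this yields at once the
    summation bound over arbitrary finite index sets and the convergence of the
    truncations. *)
Lemma rnorm_sub_finite_vector H (y : ell2 H) (J : seq nat) : uniq J ->
  rnorm (y - finite_vector J y) ^+ 2 = rnorm y ^+ 2 - \sum_(j <- J) rnorm (y j) ^+ 2.
Proof.
move=> uJ; rewrite sqr_rnormB rnorm_finite_vector// hdot_finite_vector raddf_sum/=.
under [X in _ - X *+ 2]eq_bigr do rewrite -rnorm_sqr.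
by rewrite mulr2n opprD addrA addrK.
Qed.

Lemma ell2_sum_seq_le H (y : ell2 H) (J : seq nat) : uniq J ->
  \sum_(j <- J) rnorm (y j) ^+ 2 <= rnorm y ^+ 2.
Proof. by move=> uJ; rewrite -subr_ge0 -rnorm_sub_finite_vector// sqr_ge0. Qed.

Lemma cvg_truncation H (x : ell2 H) : (fun n => finite_vector (index_iota 0 n) x) @ \oo --> x.
Proof.
apply/cvg_rnormP => e e0.
have : cvgn (series (fun i => rnorm (x i) ^+ 2)) by exact: ell2P.
move=> /cvgrPdist_le/(_ _ (exprn_gt0 2 e0))[N _ hN].
exists N => n /hN /=; rewrite -ell2_rnorm_sqr rnormC => h.
rewrite -ler_sqr ?nnegrE ?rnorm_ge0 ?(ltW e0)// rnorm_sub_finite_vector ?iota_uniq//.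
exact: le_trans (ler_norm _) h.
Qed.

(** The entry (i, j) of T is the i-th coordinate of T on the j-th summand. As the
    ampliations of P act diagonally, invariance of their ranges can be tested
    entry by entry; the uniform bound on finite submatrices holds for the matrix
    of any bounded operator. *)
Lemma matrix_space_AlgP H (L : set 'B(H, H)) (T : 'B(ell2 H, ell2 H)) :
  matrix_space (Alg L) T <->
  forall P, L P -> forall x, ampl P (T (ampl P x)) = T (ampl P x).
Proof.
split=> [[A [AL _ AT]] P LP x|TL].
  apply: ell2P_eq => i; rewrite amplE.
  have c := AT (ampl P x) i; have c' := cvg_bop (T:=P) c.
  apply: (cvg_unique_hilbert c').
  have -> : (fun n => P (series (fun j => A i j (ampl P x j)) n)) =
      series (fun j => A i j (ampl P x j)); last exact: c.
  apply/funext => n; rewrite /series/= bop_sum; apply: eq_bigr => j _.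
  by rewrite amplE; have /AlgP -> := AL i j.
exists (fun i j => coord H i \ob T \ob ell2_inj H j); split.
- move=> i j; apply/AlgP => P LP x; rewrite !bop_compE !coordE.
  have -> : ell2_inj H j (P x) = ampl P (ell2_inj H j x).
    apply: ell2P_eq => k; rewrite amplE !ell2_injE; case: eqP => //.
    by rewrite bop0.
  by rewrite -amplE TL.
- have [M M0 MT] := bop_bounded T; exists M => I J x uI uJ.
  have E i : \sum_(j <- J) (coord H i \ob T \ob ell2_inj H j) (x j) =
      T (finite_vector J x) i.
    by rewrite -coordE !bop_sum.
  under eq_bigr do rewrite E.
  apply: le_trans (ell2_sum_seq_le _ uI) _.
  by rewrite -rnorm_finite_vector// -exprMn lerXn2r ?nnegrE ?mulr_ge0 ?rnorm_ge0.
- move=> x i; rewrite -coordE.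
  have c := cvg_bop (T:=coord H i) (cvg_bop (T:=T) (cvg_truncation (x:=x))).
  have -> : series (fun j => (coord H i \ob T \ob ell2_inj H j) (x j)) =
    (fun n => coord H i (T (finite_vector (index_iota 0 n) x))); last exact: c.
  by apply/funext => n; rewrite /series/= !bop_sum.
Qed.

Lemma sum_subset_le (T : eqType) (s t : seq T) (f : T -> R) :
  (forall x, 0 <= f x) -> uniq s -> {subset s <= t} ->
  \sum_(x <- s) f x <= \sum_(x <- t) f x.
Proof.
move=> f0; elim: s t => [|x s IH] t /=; first by rewrite big_nil sumr_ge0.
move=> /andP[xs us] st; rewrite big_cons (big_rem _ (st x (mem_head _ _)))/=.
rewrite lerD2l; apply: IH => // y ys.
have : y \in t by rewrite st// inE ys orbT.
rewrite (perm_mem (perm_to_rem (st x (mem_head _ _)))) inE => /orP[/eqP yx|//].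
by move: xs; rewrite -yx ys.
Qed.

End ell2_coordinates.

(** * The isometry between the infinite direct sums *)

Section isometry.
Variables (R : realType) (H K : hilbertType R).
Local Notation C := R[i].
Variables (b : nat -> H) (u : nat -> K).
Hypothesis b_on : orthonormal_seq b.
Hypothesis b_total : total_seq b.
Hypothesis u_unit : forall n, b n = 0 \/ rnorm (u n) = 1.

Lemma rnorm_transferred_coef k (y : H) : rnorm (hdot y (b k) *: u k) = coef b y k.
Proof.
have [b0|u1] := u_unit k; last by rewrite rnormZ u1 mulr1.
by rewrite /coef b0 hdot0r scale0r !rnorm0.
Qed.

(** Each coordinate of W x is one term <x_n, b_k> u_k, with (k, n) coded by the
    index of the coordinate. Partial sums of |W x|^2 are bounded by finite double
    sums, to which Bessel's inequality applies; Parseval's identity gives the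
    opposite inequality. *)
Lemma exists_isometry : exists W : 'B(ell2 H, ell2 K),
  (forall x, rnorm (W x) = rnorm x) /\
  (forall x m, W x m = if pickle_inv m is Some p then hdot (x p.2) (b p.1) *: u p.1 else 0).
Proof.
pose f (x : ell2 H) (m : nat) : K :=
  if pickle_inv m is Some p then hdot (x p.2) (b p.1) *: u p.1 else 0.
pose g (x : ell2 H) (p : nat * nat) := coef b (x p.2) p.1 ^+ 2.
have g0 x p : 0 <= g x p by exact: sqr_ge0.
have le1 x n : \sum_(i < n) rnorm (f x i) ^+ 2 <= rnorm x ^+ 2.
  (* the pairs coded below n, and then a square [0, B) x [0, B) around them *)
  pose s : seq (nat * nat) := pmap pickle_inv (iota 0 n).
  have us : uniq s.
    by apply: (@pmap_uniq _ _ pickle_inv pickle); [exact: pickle_invK|exact: iota_uniq].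
  have -> : \sum_(i < n) rnorm (f x i) ^+ 2 = \sum_(p <- s) g x p.
    rewrite -(big_mkord xpredT (fun i => rnorm (f x i) ^+ 2)) /index_iota subn0 /s.
    elim: (iota 0 n) => [|m r IH]; first by rewrite !big_nil.
    rewrite big_cons IH /= /f; case: (pickle_inv m : option (nat * nat)) => [p|] /=.
      by rewrite big_cons rnorm_transferred_coef.
    by rewrite rnorm0 expr0n add0r.
  have [B sB] : exists B, forall p, p \in s -> (p.1 < B)%N /\ (p.2 < B)%N.
    exists (\max_(p <- s) maxn p.1 p.2).+1 => p ps.
    have := @leq_bigmax_seq _ s xpredT (fun p : nat * nat => maxn p.1 p.2) _ ps isT.
    by rewrite geq_max => /andP[].
  pose t := [seq (k, m) | m <- iota 0 B, k <- iota 0 B].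
  have st : {subset s <= t}.
    move=> [k m] /sB[kB mB]; apply/allpairsP; exists (m, k).
    by split=> //; rewrite mem_iota.
  apply: le_trans (sum_subset_le (g0 x) us st) _.
  rewrite /t big_allpairs_dep/=; apply: le_trans (ell2_sum_le x B).
  rewrite -(big_mkord xpredT (fun i => rnorm (x i) ^+ 2)) /index_iota subn0.
  apply: ler_sum => m _; rewrite (_ : iota 0 B = index_iota 0 B).
    by rewrite big_mkord; exact: (bessel b_on B (x m)).
  by rewrite /index_iota subn0.
have [||| W WE] := @exists_bop_ell2 R (ell2 H) K f 1.
- exact: ler01.
- move=> m a x y; rewrite /f; case: (pickle_inv m : option (nat * nat)) => [p|].
    by rewrite ell2DE ell2ZE hdotDl hdotZl scalerDl scalerA.
  by rewrite scaler0 addr0.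
- by move=> x n; rewrite mul1r; exact: le1.
exists W; split => // x; apply/eqP; rewrite eq_le; apply/andP; split.
  apply: ell2_rnorm_le; rewrite ?rnorm_ge0// => n; rewrite /series/= big_mkord.
  by under eq_bigr do rewrite WE; exact: le1.
apply: ell2_rnorm_le; rewrite ?rnorm_ge0// => n; rewrite /series/=.
have c : (fun B => \sum_(0 <= m < n) \sum_(k < B) coef b (x m) k ^+ 2) @ \oo -->
    \sum_(0 <= m < n) rnorm (x m) ^+ 2.
  apply: cvg_big => [|m _]; first exact: add_continuous.
  exact: parseval.
rewrite -(cvg_lim (@Rhausdorff R) c); apply: limr_le; first exact/cvgP/c.
apply: nearW => B.
pose t := [seq pickle (k, m) | m <- iota 0 n, k <- iota 0 B].
have ut : uniq t.
  apply: allpairs_uniq; rewrite ?iota_uniq// => -[m k] [m' k'] _ _ /=.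
  by move=> /(pcan_inj pickleK_inv)[-> ->].
apply: le_trans (ell2_sum_seq_le (W x) ut).
rewrite /t big_allpairs_dep/= /index_iota subn0 le_eqVlt; apply/orP; left; apply/eqP.
apply: eq_bigr => m _; rewrite -(big_mkord xpredT (fun k => coef b (x m) k ^+ 2)).
rewrite /index_iota subn0; apply: eq_bigr => k _.
by rewrite WE /f pickleK_inv rnorm_transferred_coef.
Qed.

Lemma isometry_hdot (E F : hilbertType R) (W : 'B(E, F)) :
  (forall x, rnorm (W x) = rnorm x) -> forall x y, hdot (W x) (W y) = hdot x y.
Proof.
move=> Wi x y; have W2 z : hdot (W z) (W z) = hdot z z by rewrite !hdot_rnorm Wi.
rewrite [LHS]dot_polarization [RHS]dot_polarization.
by rewrite -!bopZ -!bopD -!bopB !W2.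
Qed.

End isometry.

(** * Comparing hyperreflexivity constants through an isometry *)

Section hyperreflexivity_comparison.
Variables (R : realType).
Local Notation C := R[i].
Implicit Types (H K : hilbertType R).

Lemma opnorm_has_ubound H K (T : 'B(H, K)) :
  has_ubound [set rnorm (T x) | x in [set x | `|x| <= 1]].
Proof.
have [M M0 MT] := bop_bounded T; exists M => _ [x /= x1 <-].
apply: le_trans (MT x) _; rewrite ler_piMr// -lecR rnormE; exact: x1.
Qed.

Lemma opnorm_ub H K (T : 'B(H, K)) x : rnorm x <= 1 -> rnorm (T x) <= opnorm T.
Proof.
move=> x1; apply: ub_le_sup; first exact: opnorm_has_ubound.
by exists x => //=; rewrite -rnormE lecR.
Qed.

Lemma opnorm_le H K (T : 'B(H, K)) (M : R) :
  (forall x, rnorm x <= 1 -> rnorm (T x) <= M) -> opnorm T <= M.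
Proof.
move=> TM; apply: ge_sup; first by exists (rnorm (T 0)), 0 => //=; rewrite normr0 ler01.
by move=> _ [x /= x1 <-]; apply: TM; rewrite -lecR rnormE.
Qed.

Lemma opnorm_ge0 H K (T : 'B(H, K)) : 0 <= opnorm T.
Proof. by apply: le_trans (opnorm_ub T (x:=0) _); rewrite ?rnorm_ge0// rnorm0. Qed.

Lemma op_dist_le H K (T S : 'B(H, K)) (X : set 'B(H, K)) : X S ->
  op_dist T X <= opnorm (T - S).
Proof.
move=> XS; apply: ge_inf; last by exists S.
by exists 0 => _ [Z _ <-]; exact: opnorm_ge0.
Qed.

Lemma refl_seminorm_has_ubound H K (X : set 'B(H, K)) (T : 'B(H, K)) :
  has_ubound [set r | exists xi eta, [/\ `|xi| = 1, `|eta| = 1,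
    forall S, X S -> hdot (S xi) eta = 0 & r = rnorm (hdot (T xi) eta : C)]].
Proof.
exists (opnorm T) => _ [xi [eta [xi1 eta1 _ ->]]].
have {xi1}x1 : rnorm xi = 1 by rewrite /rnorm xi1.
have {eta1}e1 : rnorm eta = 1 by rewrite /rnorm eta1.
by apply: le_trans (hdot_CauchySchwarz _ _) _; rewrite e1 mulr1 opnorm_ub// x1.
Qed.

Lemma rnormM (a c : C) : rnorm (a * c : C) = rnorm (a : C) * rnorm (c : C).
Proof. exact: (@rnormZ _ C^o). Qed.

Lemma rnorm_conj (a : C) : rnorm (a^* : C) = rnorm (a : C).
Proof. by rewrite /rnorm norm_conjC. Qed.

Lemma rnorm_eq1 H (x : H) : (`|x| = 1) <-> rnorm x = 1.
Proof. by rewrite -rnormE; split=> [/complexI|->]. Qed.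

Lemma refl_seminorm_ge0 H K (X : set 'B(H, K)) (T : 'B(H, K)) : 0 <= refl_seminorm X T.
Proof.
have := refl_seminorm_has_ubound X T; rewrite /refl_seminorm; set A := [set _ | _] => Aub.
have [[r Ar]|/set0P/negP/negPn/eqP ->] := pselect (A !=set0); last by rewrite sup0.
apply: le_trans (ub_le_sup Aub Ar).
by case: Ar => xi [eta [_ _ _ ->]]; exact: (@rnorm_ge0 _ C).
Qed.

(** The seminorm is defined with unit vectors; a compression of unit vectors by
    the adjoint of an isometry only has norm at most 1. *)
Lemma refl_seminorm_ub H K (X : set 'B(H, K)) (T : 'B(H, K)) xi eta :
  rnorm xi <= 1 -> rnorm eta <= 1 -> (forall S, X S -> hdot (S xi) eta = 0) ->
  rnorm (hdot (T xi) eta : C) <= refl_seminorm X T.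
Proof.
move=> xi1 eta1 X0.
have [->|xi0] := pselect (xi = 0).
  by rewrite bop0 hdot0l (@rnorm0 _ C) refl_seminorm_ge0.
have [->|eta0] := pselect (eta = 0).
  by rewrite hdot0r (@rnorm0 _ C) refl_seminorm_ge0.
have p := rnorm_gt0 xi0; have q := rnorm_gt0 eta0.
pose xi' := ((rnorm xi)^-1%:C%C : C) *: xi; pose eta' := ((rnorm eta)^-1%:C%C : C) *: eta.
have xiE : xi = ((rnorm xi)%:C%C : C) *: xi'.
  by rewrite scalerA -rmorphM/= divff ?gt_eqF// scale1r.
have etaE : eta = ((rnorm eta)%:C%C : C) *: eta'.
  by rewrite scalerA -rmorphM/= divff ?gt_eqF// scale1r.
have h : rnorm (hdot (T xi') eta' : C) <= refl_seminorm X T.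
  apply: ub_le_sup; first exact: refl_seminorm_has_ubound.
  exists xi', eta'; split=> //.
  - exact/rnorm_eq1/rnorm_normalize.
  - exact/rnorm_eq1/rnorm_normalize.
  - by move=> S XS; rewrite bopZ hdotZl hdotZr X0// !mulr0.
apply: le_trans h; rewrite [in leLHS]xiE [in leLHS]etaE.
rewrite [in leLHS]bopZ hdotZl hdotZr !rnormM rnorm_conj !rnormR.
rewrite !ger0_norm ?rnorm_ge0// mulrA ler_piMl ?(@rnorm_ge0 _ C)//.
by apply: mulr_ile1; rewrite ?rnorm_ge0.
Qed.

Section compression.
Variables (E F : hilbertType R) (W : 'B(E, F)) (V : 'B(F, E)).
Hypothesis W_iso : forall x, rnorm (W x) = rnorm x.
Hypothesis WV : is_adjoint W V.

Lemma adjoint_isometryK x : V (W x) = x.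
Proof. by apply: hdot_eqr => y; rewrite -WV isometry_hdot. Qed.

Lemma adjoint_isometry_le y : rnorm (V y) <= rnorm y.
Proof.
have [->|Vy0] := pselect (V y = 0); first by rewrite rnorm0 rnorm_ge0.
rewrite -(ler_pM2l (rnorm_gt0 Vy0)) -expr2 rnorm_sqr -WV.
apply: le_trans (Re_le_rnorm _) _; apply: le_trans (hdot_CauchySchwarz _ _) _.
by rewrite W_iso.
Qed.

Variables (X1 : set 'B(E, E)) (X2 : set 'B(F, F)).
Hypothesis X2_0 : X2 !=set0.
Hypothesis X21 : forall S, X2 S -> X1 (V \ob S \ob W).
Hypothesis X12 : forall S, X1 S -> X2 (W \ob S \ob V).

Lemma compressionK T : V \ob (W \ob T \ob V) \ob W = T.
Proof. by apply: bop_eq => x; rewrite !bop_compE !adjoint_isometryK. Qed.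

(** Compression by the isometry is contractive, maps X2 into X1, and takes the
    dilation of T back to T. *)
Lemma op_dist_dilation T : op_dist T X1 <= op_dist (W \ob T \ob V) X2.
Proof.
have [S0 XS0] := X2_0.
apply: lb_le_inf; first by exists (opnorm ((W \ob T \ob V) - S0)), S0.
move=> _ [S XS <-]; apply: le_trans (op_dist_le T (X21 XS)) _.
apply: opnorm_le => x x1.
have -> : (T - (V \ob S \ob W)) x = V (((W \ob T \ob V) - S) (W x)).
  by rewrite !bopBE bopB !bop_compE !adjoint_isometryK.
by apply: le_trans (adjoint_isometry_le _) _; rewrite opnorm_ub// W_iso.
Qed.

(** The adjoint of the isometry maps a pair of vectors annihilated by X2 to a pair
    annihilated by X1. *)
Lemma refl_seminorm_dilation T : refl_seminorm X2 (W \ob T \ob V) <= refl_seminorm X1 T.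
Proof.
rewrite {1}/refl_seminorm; set A := [set _ | _].
have [A0|/set0P/negP/negPn/eqP ->] := pselect (A !=set0); last by rewrite sup0 refl_seminorm_ge0.
apply: ge_sup => // _ [xi [eta [/rnorm_eq1 xi1 /rnorm_eq1 eta1 X0 ->]]].
rewrite !bop_compE WV; apply: refl_seminorm_ub.
- by rewrite -xi1; exact: adjoint_isometry_le.
- by rewrite -eta1; exact: adjoint_isometry_le.
- by move=> S XS; rewrite -WV -(X0 _ (X12 XS)).
Qed.

Lemma dilation_setT : X2 = setT -> X1 = setT.
Proof. by move=> X2T; apply/seteqP; split=> // T _; rewrite -(compressionK T); apply: X21; rewrite X2T. Qed.

(** The full operator space has constant 1 by convention, so X2 is required to
    be full when X1 is. *)
Lemma hyperreflexivity_const_le : (X1 = setT -> X2 = setT) ->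
  (hyperreflexivity_const X1 <= hyperreflexivity_const X2)%E.
Proof.
move=> T12; rewrite /hyperreflexivity_const.
case: (asboolP (X1 = setT)) => [/T12 X2T|X1T]; first by case: asboolP.
case: (asboolP (X2 = setT)) => [X2T|X2T]; first by case: X1T; exact: dilation_setT.
case: (asboolP (hyperreflexive X2)) => [[k k0 hk]|_]; last exact: leey.
have d0 T : 0 <= op_dist T X1.
  have [S0 XS0] := X2_0.
  apply: lb_le_inf; first by exists (opnorm (T - (V \ob S0 \ob W))), (V \ob S0 \ob W) => //; exact: X21.
  by move=> _ [S _ <-]; exact: opnorm_ge0.
case: (asboolP (hyperreflexive X1)) => [X1h|]; last first.
  case; exists k => // T; apply: le_trans (op_dist_dilation T) _.
  apply: le_trans (hk _) _; rewrite ler_pM2l//; exact: refl_seminorm_dilation.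
apply: ge_ereal_sup => _ [T XT <-].
have XT' : ~ X2 (W \ob T \ob V).
  by move=> /X21; rewrite compressionK.
apply: (@le_trans _ _ (op_dist (W \ob T \ob V) X2 / refl_seminorm X2 (W \ob T \ob V))%:E).
  rewrite lee_fin.
  have := op_dist_dilation T; have := refl_seminorm_dilation T; have := hk (W \ob T \ob V).
  have := refl_seminorm_ge0 X2 (W \ob T \ob V).
  have := d0 T.
  set d := op_dist T X1; set d' := op_dist _ X2.
  set r := refl_seminorm X1 T; set r' := refl_seminorm X2 _ => d0T r0 d'r' r'r dd'.
  (* when r' = 0 hyperreflexivity forces d' = 0, so both quotients vanish *)
  have [r'0|r'0] := eqVneq r' 0.
    rewrite r'0 mulr0 in d'r'.
    by rewrite (_ : d = 0) ?r'0 ?mul0r ?invr0 ?mulr0//; apply/eqP; rewrite eq_le d0T (le_trans dd').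
  have rp : 0 < r' by rewrite lt_neqAle eq_sym r'0.
  by apply: ler_pM => //; rewrite ?invr_ge0 ?(le_trans r0)// lef_pV2 ?posrE// (lt_le_trans rp).
by apply: ereal_sup_ubound; exists (W \ob T \ob V).
Qed.

End compression.

End hyperreflexivity_comparison.

(** * Isomorphic totally atomic lattices *)

Section final.
Variables (R : realType).
Local Notation C := R[i].

(** W intertwines the ampliations of P and phi P since the pair b_k, u_k does, and
    taking adjoints V does so in the other direction; hence both conjugations
    preserve invariance of the ranges. *)
Lemma exists_intertwining_isometry (H K : hilbertType R) (L1 : set 'B(H, H)) (L2 : set 'B(K, K))
    (phi : 'B(H, H) -> 'B(K, K)) (b : nat -> H) (u : nat -> K) :
  (forall P, L1 P -> is_projection P) -> (forall P, L2 P -> is_projection P) ->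
  (forall P, L1 P -> L2 (phi P)) -> (forall Q, L2 Q -> exists2 P, L1 P & phi P = Q) ->
  orthonormal_seq b -> total_seq b -> (forall n, b n = 0 \/ rnorm (u n) = 1) ->
  (forall n P, L1 P ->
    (P (b n) = b n /\ phi P (u n) = u n) \/ (P (b n) = 0 /\ phi P (u n) = 0)) ->
  exists (W : 'B(ell2 H, ell2 K)) (V : 'B(ell2 K, ell2 H)),
    [/\ forall x, rnorm (W x) = rnorm x, is_adjoint W V,
      forall S, matrix_space (Alg L2) S -> matrix_space (Alg L1) (V \ob S \ob W) &
      forall S, matrix_space (Alg L1) S -> matrix_space (Alg L2) (W \ob S \ob V)].
Proof.
move=> L1p L2p phiL phi_onto bon btot uu bu.
have [W [Wi WE]] := exists_isometry bon btot uu.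
have [V WV] := exists_adjoint W.
have cW P x : L1 P -> W (ampl P x) = ampl (phi P) (W x).
  move=> LP; apply: ell2P_eq => m; rewrite amplE !WE; case: pickle_inv => [[k n]|] /=.
    rewrite amplE bopZ (proj_sa _ _ (L1p _ LP)).
    by have [[-> ->]//|[-> ->]] := bu k _ LP; rewrite hdot0r scale0r scaler0.
  by rewrite bop0.
have cV P y : L1 P -> V (ampl (phi P) y) = ampl P (V y).
  move=> LP; apply: hdot_eqr => x; rewrite -WV.
  have [_ Pa] := L1p _ LP; have [_ Qa] := L2p _ (phiL _ LP).
  by rewrite -(ampl_adjoint Qa) -(ampl_adjoint Pa) -WV cW.
exists W, V; split=> // S /matrix_space_AlgP SL; apply/matrix_space_AlgP.
  by move=> P LP x; rewrite !bop_compE cW// -cV// SL//; exact: phiL.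
by move=> _ /phi_onto[P LP <-] y; rewrite !bop_compE cV// -cW// SL.
Qed.

Lemma adjoints_rank1 (H K : hilbertType R) (M : set 'B(K, H)) (x : H) (y : K) :
  M (rank1 x y) -> adjoints M (rank1 y x).
Proof. by exists (rank1 x y) => //; exact: rank1_adjoint. Qed.

End final.

Theorem corollary4p5 (R : realType) (H1 H2 : hilbertType R)
  (H1_separable : separable_space H1) (H2_separable : separable_space H2)
  (L1 : set 'B(H1, H1)) (L2 : set 'B(H2, H2))
  (L1_CSL : CSL L1) (L2_CSL : CSL L2)
  (L1_totally_atomic : totally_atomic L1)
  (L2_totally_atomic : totally_atomic L2)
  (L1_iso_L2 : CSL_isomorphic L1 L2) :
  weak_TRO_equivalent (Alg L1) (Alg L2) /\
  complete_hyperreflexivity_const (Alg L1) =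
  complete_hyperreflexivity_const (Alg L2).
Proof.
have L1p P : L1 P -> is_projection P by case: L1_CSL => -[h _ _ _ _] _; exact: h.
have L2p P : L2 P -> is_projection P by case: L2_CSL => -[h _ _ _ _] _; exact: h.
have [phi [phiL _ phi_surj] phi_le] := L1_iso_L2.
have phi_onto Q : L2 Q -> exists2 P, L1 P & phi P = Q by move=> /phi_surj.
(* psi is the inverse of phi on L2 *)
have /choice[psi psiP] Q : exists P, L2 Q -> L1 P /\ phi P = Q.
  have [/phi_onto[P LP PQ]|nL] := pselect (L2 Q); first by exists P.
  by exists 0 => /nL.
have psiL Q : L2 Q -> L1 (psi Q) by move=> /psiP[].
have phiK Q : L2 Q -> phi (psi Q) = Q by move=> /psiP[].
have psi_le P Q : L2 P -> L2 Q -> (proj_le P Q <-> proj_le (psi P) (psi Q)).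
  move=> LP LQ; have := phi_le _ _ (psiL _ LP) (psiL _ LQ).
  by rewrite !phiK// => h; exact: iff_sym.
have psiK P : L1 P -> psi (phi P) = P.
  move=> LP; have LP' := phiL _ LP.
  have phiphi := phiK _ LP'.
  have [h1 h2] : proj_le P (psi (phi P)) /\ proj_le (psi (phi P)) P.
    split; apply/phi_le => //; rewrite ?phiphi; try exact: psiL;
    by apply/proj_leP => x; exact: proj_idem (L2p _ LP').
  (* proj_le is antisymmetric on commuting projections *)
  have := L1_CSL.2 P (psi (phi P)) LP (psiL _ LP').
  by rewrite h1 h2.
have psi_onto P : L1 P -> exists2 Q, L2 Q & psi Q = P.
  by move=> LP; exists (phi P); [exact: phiL|exact: psiK].
have [b [u [bon btot bu1 bu]]] := intertwining_sequences L1_CSL L2_CSL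
  L1_totally_atomic H1_separable phiL phi_le.
have [c [v [con ctot cv1 cv]]] := intertwining_sequences L2_CSL L1_CSL
  L2_totally_atomic H2_separable psiL psi_le.
split.
  pose M := [set T : 'B(H2, H1) | forall P, L1 P -> T \ob phi P = P \ob T].
  have M_TRO : TRO M by apply: TRO_intertwiners => // P LP; exact/L2p/phiL.
  have Mbu n : M (rank1 (b n) (u n)).
    by move=> P LP; exact: (rank1_bu_intertwines L2p phiL bu n LP).
  have Mvc n : M (rank1 (v n) (c n)).
    move=> P LP; have := rank1_ub_intertwines L2p cv n (phiL _ LP).
    by rewrite psiK.
  have MP T P : M T -> L1 P -> T \ob phi P = P \ob T by move=> h; exact: h.
  have M'P S P : adjoints M S -> L1 P -> S \ob P = phi P \ob S.
    move=> [T MT TS] LP.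
    have [_ Pa] := L1p _ LP; have [_ Qa] := L2p _ (phiL _ LP).
    apply: (is_adjoint_unique (is_adjoint_comp TS Pa)).
    by rewrite -(MP _ _ MT LP); exact: is_adjoint_comp.
  exists M, M; split=> //; apply/seteqP; split.
  - apply: (Alg_sub_wstar_span L1p L2p phiL phi_onto bon btot bu1 bu) => // n.
    exact: adjoints_rank1.
  - exact: (wstar_span_compression L1p phiL).
  - apply: (Alg_sub_wstar_span L2p L1p psiL psi_onto con ctot cv1 cv) => // n.
    exact: adjoints_rank1.
  - apply: (wstar_span_compression L2p psiL) => T Q MT LQ.
      by rewrite (M'P _ _ MT (psiL _ LQ)) phiK.
    by rewrite -(MP _ _ MT (psiL _ LQ)) phiK.
have [W [V [Wi WV W21 W12]]] := exists_intertwining_isometry L1p L2p phiL phi_onto bon btot bu1 bu.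
have [W' [V' [Wi' WV' W21' W12']]] := exists_intertwining_isometry L2p L1p psiL psi_onto con ctot cv1 cv.
have X0 (H : hilbertType R) (L : set 'B(H, H)) : matrix_space (Alg L) !=set0.
  by exists 0; apply/matrix_space_AlgP => P LP x; rewrite bop0E bop0.
apply/eqP; rewrite eq_le; apply/andP; split.
  apply: (hyperreflexivity_const_le Wi WV) => // h.
  exact: (dilation_setT Wi' WV' W21' h).
apply: (hyperreflexivity_const_le Wi' WV') => // h.
exact: (dilation_setT Wi WV W21 h).
Qed.
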